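(* Let $I=[0,1]$ with Lebesgue measure $m$. Let $\tau_n:I\to I$, $n=1,2,\dots$, be piecewise expanding maps converging uniformly on $I$ to a map $\tau:I\to I$. Assume that the $\tau_n$ satisfy the Lasota–Yorke inequality with common constants $A<1$ and $B$. Then, for any density $f\in BV(I)$, the sequence $$f_n=\frac1n\sum_{i=1}^nP_{\tau_{(1,i)}}f,\qquad n\ge1,$$ where $\tau_{(1,i)}=\tau_i\circ\tau_{i-1}\circ\dots\circ\tau_1$, forms a precompact set in $L^1(I,m)$, and any convergent (in $L^1$) subsequence of it converges to a density of an absolutely continuous invariant measure of the limit map $\tau$.
   Context: A map $T:I\to I$ is called piecewise expanding if there is a finite partition $\{I_i=[a_{i-1},a_i]: i=1,\dots,q\}$ of $I$ such that: (i) $T$ is monotonic on each $I_i$ (values at partition endpoints being understood through one-sided limits from the interior); (ii) $T_i:=T|_{I_i}$ is $C^2$, i.e. $C^2$ in the interior of $I_i$ with finite one-sided limits of the derivatives at the endpoints; (iii) there is a constant $s>1$ with $|T_i'(x)|\ge s$ for all $i$ and all $x\in(a_{i-1},a_i)$. A measurable map $T:I\to I$ is non-singular if $m(A)=0$ implies $m(T^{-1}(A))=0$. For non-singular $T$ the Frobenius–Perron operator $P_T:L^1(I,m)\to L^1(I,m)$ is defined by letting $P_Tf$ be the Radon–Nikodym derivative $\frac{d(T_*(f\cdot m))}{dm}$, where $T_*\mu(A)=\mu(T^{-1}A)$; equivalently $\int_I P_Tf\cdot g\,dm=\int_I f\cdot (g\circ T)\,dm$ for all $g\in L^\infty(I,m)$.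 $V(f)$ denotes the variation of $f$ on $I$, and $BV(I)$ the functions of bounded variation (functions in $BV(I)$ are modified so that $f(x_0)=\limsup_{x\to x_0}f(x)$ for all $x_0\in I$). A density is a function $f\ge0$ with $\int_I f\,dm=1$. A piecewise expanding map $T$, with finite partition $\{I_i=[a_{i-1},a_i]: i=1,\dots,q\}$ of $I$ such that $T$ is monotonic and $C^2$ on each $I_i$ (values and derivatives at partition endpoints being understood through one-sided limits from the interior), with constant $s>1$ such that $|T_i'(x)|\ge s$ for all $i$ and all $x\in(a_{i-1},a_i)$, and with $h=\min_i m(I_i)$, satisfies the Lasota–Yorke inequality $$V(P_Tf)\le A_T\,V(f)+B_T\int_I|f|\,dm\quad\text{for all } f\in BV(I),$$ where $A_T=\frac2s$ and $B_T=\frac{\max|T''|}{s}+\frac2h$. The maps $\tau_n$ satisfy the Lasota–Yorke inequality with common constants $A<1$ and $B$ if, for suitable partitions and expansion constants $s$ of the $\tau_n$, $A_{\tau_n}\le A$ and $B_{\tau_n}\le B$ for all $n$; in particular $V(P_{\tau_n}f)\le A\,V(f)+B\int_I|f|\,dm$ for all $n$ and all $f\in BV(I)$. An absolutely continuous invariant measure (acim) of $\tau$ is a probability measure $\mu\ll m$ with $\mu(\tau^{-1}(E))=\mu(E)$ for all Borel $E$; its density is $d\mu/dm$. *)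

(* Defs.v *)
(* MathComp / MathComp-Analysis development. *)
From HB Require Import structures.
From mathcomp Require Import all_boot all_order all_algebra.
From mathcomp Require Import all_classical all_reals all_analysis.
From mathcomp Require Import measurable_realfun.

Set Implicit Arguments.
Unset Strict Implicit.
Unset Printing Implicit Defensive.

Import Order.TTheory GRing.Theory Num.Theory.
Import numFieldNormedType.Exports.

Local Open Scope classical_set_scope.
Local Open Scope ring_scope.

Section unit_interval.
Variable R : realType.

Definition I01 : set R := `[0, 1]%classic.

Lemma measurable_I01 : measurable (I01 : set (measurableTypeR R)).
Proof. exact: measurable_itv. Qed.

Lemma lebesgue_I01_lty :
  ((lebesgue_measure : set (measurableTypeR R) -> \bar R) I01 < +oo)%E.
Proof. by rewrite /I01 lebesgue_measure_itv /= lte_fin ltr01 -EFinB ltry. Qed.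

(* [mI] is a measure on all of [R], concentrated on [I01], so that
   [L^1(R, mI) = L^1([0, 1])]. *)
Definition mI : set (measurableTypeR R) -> \bar R :=
  mfrestr measurable_I01 lebesgue_I01_lty.

HB.instance Definition _ := FiniteMeasure.on mI.

End unit_interval.

Arguments I01 {R}.
Arguments mI {R}.

Section L1.
Variable R : realType.

(* [L1fun R] consists of the integrable functions, [L1 R] of their classes
   modulo equality [mI]-almost everywhere. *)
Definition L1fun := LfunType (@mI R) (@lexx _ _ 1%E).
Definition L1 := LspaceType (@mI R) (@lexx _ _ 1%E).

HB.instance Definition _ := GRing.Lmodule.on L1fun.
HB.instance Definition _ := gen_eqMixin L1.
HB.instance Definition _ := gen_choiceMixin L1.

Definition L1_fun (u : L1) : R -> R := aqEqMfun_to_fun (LebesgueSpace.sort u).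

Lemma L1_fun_Lfun (u : L1) : L1_fun u \in Lfun mI 1.
Proof.
have mu : measurable_fun [set: measurableTypeR R] (L1_fun u).
  exact: (@measurable_funPT _ _ _ _ (repr (LebesgueSpace.sort u))).
apply/andP; split; rewrite inE//=.
exact: (@Lebesgue_finite _ _ _ _ _ _ u).
Qed.

Lemma L1_fun_integrable (u : L1) : mI.-integrable setT (EFin \o L1_fun u).
Proof. exact/Lfun1_integrable/L1_fun_Lfun. Qed.

Lemma L1fun_integrable (f : L1fun) : mI.-integrable setT (EFin \o f).
Proof. exact/Lfun1_integrable/LfunP. Qed.

Section L1_class.
Variable f : L1fun.
Local Open Scope quotient_scope.

(* The library's Lebesgue spaces use [measurableTypeR R], rather than [R], as
   codomain. *)
Let fR : measurableTypeR R -> measurableTypeR R := f.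

Let measurable_fR : measurable_fun setT fR.
Proof. exact: (@measurable_funPT _ _ _ _ (f : LfunType _ _)). Qed.

HB.instance Definition _ := isMeasurableFun.Build _ _ _ _ fR measurable_fR.

Let cls : {mfun_ (@mI R), measurableTypeR R >-> measurableTypeR R} :=
  \pi_({mfun_ (@mI R), measurableTypeR R >-> measurableTypeR R}) fR.

Let clsE : ae_eq mI setT (aqEqMfun_to_fun cls) f.
Proof.
have /eqmodP/asboolP : repr cls = fR
  %[mod {mfun_ (@mI R), measurableTypeR R >-> measurableTypeR R}]
  by rewrite reprK.
by apply: filterS => x.
Qed.

Let cls_finite : finite_norm mI 1 cls.
Proof.
rewrite /finite_norm Lnorm1.
rewrite (ae_eq_integral (fun x => `| (f x)%:E |)%E) //.
- by have := Lfunction_finite _ (f : LfunType _ _); rewrite /finite_norm Lnorm1.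
- apply: measurableT_comp => //.
  by apply/measurable_EFinP; exact: (@measurable_funPT _ _ _ _ (repr cls)).
- apply: measurableT_comp => //.
  exact/measurable_EFinP.
- exact: (ae_eq_comp (fun y : R => `|y%:E|%E) clsE).
Qed.

Definition to_L1 : L1 :=
  @LebesgueSpace.Pack _ _ _ _ _ _ cls
    (LebesgueSpace.Class (isFinLebesgue.Build _ _ _ _ _ _ _ cls_finite)).

Lemma to_L1E : L1_fun to_L1 = f %[ae mI].
Proof. exact: clsE. Qed.

End L1_class.

Definition L1_dist (u v : L1) : R :=
  fine 'N[mI]_1[EFin \o (fun x => L1_fun u x - L1_fun v x)%R]%E.

Lemma L1_eq (u v : L1) : L1_fun u = L1_fun v %[ae mI] -> u = v.
Proof.
case: u v => [u [[uP]]] [v [[vP]]] /= uv.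
have uvE : u = v.
  rewrite -[u]reprK -[v]reprK; apply/eqquotP/asboolP.
  exact: uv.
by move: uP vP uv; rewrite uvE => uP vP _; rewrite (Prop_irrelevance uP vP).
Qed.

Let L1_subE u v : (L1_dist u v)%:E =
  'N[mI]_1[EFin \o (fun x => L1_fun u x - L1_fun v x)%R]%E.
Proof.
rewrite /L1_dist fineK// Lnorm1 ge0_fin_numE ?integral_ge0//.
have /integrableP[] // := integrableB measurableT (L1_fun_integrable u)
  (L1_fun_integrable v).
Qed.

Let L1_distxx u : L1_dist u u = 0.
Proof.
apply: EFin_inj; rewrite L1_subE Lnorm1 integral0_eq// => x _ /=.
by rewrite subrr normr0.
Qed.

Let L1_dist_eq0 u v : L1_dist u v = 0 -> u = v.
Proof.
move=> duv; have := L1_subE u v; rewrite duv => /esym uv0; apply: L1_eq.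
have mw : measurable_fun [set: measurableTypeR R]
    (EFin \o (fun x => L1_fun u x - L1_fun v x)).
  exact: (measurable_int mI (integrableB measurableT
    (L1_fun_integrable u) (L1_fun_integrable v))).
have := @Lnorm_eq0_eq0 _ _ _ mI _ 1%E mw lte01 uv0.
by apply: filterS => x + _ => /(_ I) /= [] /eqP; rewrite subr_eq0 => /eqP.
Qed.

Let L1_distC u v : L1_dist u v = L1_dist v u.
Proof.
rewrite /L1_dist !Lnorm1; congr fine; apply: eq_integral => x _ /=.
by rewrite distrC.
Qed.

Let L1_dist_triangle v u w : L1_dist u w <= L1_dist u v + L1_dist v w.
Proof.
rewrite -lee_fin EFinD !L1_subE.
rewrite (_ : (fun x => L1_fun u x - L1_fun w x)%R =
  (fun x => L1_fun u x - L1_fun v x) \+ (fun x => L1_fun v x - L1_fun w x)).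
  apply: minkowski => //; apply/measurable_EFinP;
  exact: (measurable_int mI (integrableB measurableT
    (L1_fun_integrable _) (L1_fun_integrable _))).
by apply/funext => x /=; rewrite addrA subrK.
Qed.

HB.instance Definition _ := isMetric.Build R L1
  L1_distxx L1_dist_eq0 L1_distC L1_dist_triangle.

End L1.

Lemma mI_setD0 (R : realType) (A : set (measurableTypeR R)) :
  mI (A `\` I01) = 0%E.
Proof. by rewrite /mI /mfrestr /mrestr setDKI measure0. Qed.

Section frobenius_perron.
Variables (R : realType) (T : R -> R) (f : L1fun R).
Local Open Scope ereal_scope.
Local Open Scope charge_scope.

(* [T \_ I01] agrees with [T] on [I01] and is constant on the [mI]-null set
   outside, where [T] may fail to be measurable. *)
Let TI : measurableTypeR R -> measurableTypeR R := (T \_ I01)%FUN.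

(* The signed measure [T_*(f . mI)]. *)
Definition transported_charge (mT : measurable_fun setT TI) :
    {charge set (measurableTypeR R) -> \bar R} :=
  @measure_function_pushforward__canonical__charge_Charge _ _ _ _ TI R
    (induced_charge (L1fun_integrable f)) mT.

(* The dummy value [0] is only used for [T] not measurable. *)
Definition transported_density : measurableTypeR R -> \bar R :=
  match pselect (measurable_fun setT TI) with
  | left mT => 'd (transported_charge mT) '/d mI
  | right _ => cst 0
  end.

Lemma transported_density_Lfun : (fine \o transported_density) \in Lfun mI 1.
Proof.
apply/Lfun1_integrable; rewrite /transported_density.
case: pselect => [mT|nmT] /=; last first.
  by rewrite (_ : _ \o _ = cst 0) //; exact: integrable0.
have [dom|ndom] := pselect (transported_charge mT `<< mI).
  rewrite (_ : _ \o _ = 'd (transported_charge mT) '/d mI); last first.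
    apply/funext => x /=; rewrite fineK//; exact: Radon_Nikodym_fin_num.
  exact: Radon_Nikodym_integrable.
rewrite (_ : _ \o _ = cst 0); first exact: integrable0.
by apply/funext => x /=; rewrite /Radon_Nikodym; case: pselect.
Qed.

(* A version of [P_T f], that is, of the Radon-Nikodym derivative
   [d(T_*(f . mI)) / d mI]. *)
Definition Frobenius_Perron : L1fun R :=
  Lfun_Sub (@lexx _ _ 1%E) transported_density_Lfun.

End frobenius_perron.

Lemma Frobenius_PerronE (R : realType) (T : R -> R) (f : L1fun R)
  (mT : measurable_fun (I01 : set (measurableTypeR R))
     (T : measurableTypeR R -> measurableTypeR R))
  (nonsing : forall A : set (measurableTypeR R), measurable A -> mI A = 0%E ->
     mI (I01 `&` T @^-1` A) = 0%E)
  (A : set (measurableTypeR R)) (mA : measurable A) :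
  (\int[mI]_(x in A) (Frobenius_Perron T f x)%:E =
   \int[mI]_(x in I01 `&` T @^-1` A) (f x)%:E)%E.
Proof.
rewrite /= /transported_density; case: pselect => [mTI|]; last first.
  case; apply/(measurable_restrict _ (@measurable_I01 R) measurableT) => //.
  by rewrite setTI.
have key B : measurable B ->
  transported_charge f mTI B = (\int[mI]_(x in I01 `&` T @^-1` B) (f x)%:E)%E.
  move=> mB; rewrite /transported_charge /= /pushforward /induced_charge.
  have mTIB : measurable ((T \_ I01)%FUN @^-1` B).
    by rewrite -[X in measurable X]setTI; apply: mTI.
  have e1 : I01 `&` T @^-1` B = ((T \_ I01)%FUN @^-1` B) `&` I01.
    apply/seteqP; split => x /= []; rewrite /patch.
      by move=> Ix TB; split => //; rewrite mem_set.
    by move=> + Ix; rewrite mem_set.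
  rewrite e1 -[in LHS](@setUIDK _ ((T \_ I01)%FUN @^-1` B) I01).
  have mf : measurable_fun [set: measurableTypeR R] (EFin \o f).
    exact: (measurable_int mI (L1fun_integrable f)).
  have mI01 := @measurable_I01 R.
  rewrite integral_setU//=; last 4 first.
  - exact: measurableI.
  - exact: measurableD.
  - exact: measurable_funTS.
  - by apply/disj_setPS => x [[_ ?] [_ ?]].
  rewrite [X in (_ + X)%E](_ : _ = 0)%E ?adde0//.
  apply: null_set_integral => //.
  - exact: measurableD.
  - exact: measurable_funTS.
  - exact: mI_setD0.
have dom : transported_charge f mTI `<< mI.
  apply/null_content_dominatesP => B mB B0; rewrite key//.
  apply: null_set_integral => //.
  - by apply: mT => //; exact: measurable_I01.
  - by apply: measurable_funTS; exact: (measurable_int mI (L1fun_integrable f)).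
  - exact: nonsing.
rewrite -key// (Radon_Nikodym_integral dom mA); apply: eq_integral => x _.
by rewrite fineK// Radon_Nikodym_fin_num.
Qed.

Section piecewise_expanding.
Variable R : realType.
Implicit Types (T : R -> R) (s : seq R) (lam : R).

(* As in [itv_partition], the initial point [0] of a partition of [I01] is not
   listed in [s]: [s = [:: a_1; .. ; a_q]] with [a_q = 1]. *)
Definition node s i : R := nth 0 (0 :: s) i.

(* [T] is constrained in the interior of the pieces only; at the partition
   points its values are arbitrary, and derivatives are one-sided limits. *)
Definition piecewise_expanding_with T s lam : Prop :=
  [/\ itv_partition 0 1 s, 1 < lam &
    forall i, (i < size s)%N ->
      let a := node s i in let b := node s i.+1 in
      [/\ {in `]a, b[ &, nondecreasing_fun T} \/
            {in `]a, b[ &, nonincreasing_fun T},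
          {in `]a, b[, forall x, derivable T x 1 /\ derivable (derive1 T) x 1} /\
            {in `]a, b[, continuous (derive1n 2 T)},
          cvg (derive1 T x @[x --> a^'+]) /\ cvg (derive1 T x @[x --> b^'-]),
          cvg (derive1n 2 T x @[x --> a^'+]) /\ cvg (derive1n 2 T x @[x --> b^'-]) &
          {in `]a, b[, forall x, lam <= `|derive1 T x|} ]].

Definition piecewise_expanding T : Prop :=
  exists s lam, piecewise_expanding_with T s lam.

(* The second derivative extends continuously to each closed piece; the maximum
   of the absolute values of these extensions is the supremum over the
   interiors. *)
Definition max_derive2 T s : R :=
  sup [set y | exists i x, [/\ (i < size s)%N,
    x \in `]node s i, node s i.+1[ & y = `|derive1n 2 T x| ]].

(* The neutral element [1] is harmless: every piece has length at most [1]. *)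
Definition mesh_min s : R :=
  \big[Order.min/1]_(i < size s)
    fine (lebesgue_measure `[node s i, node s i.+1]%classic).

Definition LY_A lam : R := 2 / lam.
Definition LY_B T s lam : R := max_derive2 T s / lam + 2 / mesh_min s.

Definition common_Lasota_Yorke (tau : nat -> R -> R) (A B : R) : Prop :=
  forall n, (0 < n)%N -> exists s lam,
    [/\ piecewise_expanding_with (tau n) s lam,
        LY_A lam <= A & LY_B (tau n) s lam <= B].

End piecewise_expanding.

Section densities.
Variable R : realType.
Implicit Types (f g T : R -> R).

Definition BV_I01 f : Prop :=
  bounded_variation 0 1 f /\
  forall x0, I01 x0 -> (f x0)%:E = limf_esup (EFin \o f) (within I01 x0^').

Definition is_density f : Prop :=
  (forall x, I01 x -> 0 <= f x) /\ (\int[mI]_x (f x)%:E = 1)%E.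

Definition acim T (mu : probability (measurableTypeR R) R) : Prop :=
  [/\ measurable_fun (I01 : set (measurableTypeR R)) T, mu `<< mI &
    forall E : set (measurableTypeR R), measurable E ->
      mu (I01 `&` T @^-1` E) = mu E].

Local Open Scope charge_scope.

Definition acim_density T g : Prop :=
  exists2 mu : probability (measurableTypeR R) R, acim T mu &
    (EFin \o g : measurableTypeR R -> \bar R) =
      'd (charge_of_finite_measure mu) '/d mI %[ae mI].

End densities.

Section averages.
Variables (R : realType) (tau : nat -> R -> R).

(* [tau_(1,i)]; the sequence of maps starts at index [1]. *)
Fixpoint compose_upto i : R -> R :=
  if i is j.+1 then tau i \o compose_upto j else id.

Definition average (f : L1fun R) n : L1fun R :=
  n%:R^-1 *: \sum_(1 <= i < n.+1) Frobenius_Perron (compose_upto i) f.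

End averages.

(* Main.v *)
(**
An integrable [F] has (essential) variation at most [C] on [0, 1] if and only if
[|\int F phi'| <= C sup |phi|] for all piecewise C^1 functions [phi] that vanish
at 0 and 1.  In this dual form the Lasota-Yorke inequality is obtained as
follows (Liverani): on a branch of [T], subtract from [(phi \o T) / T'] the affine
function with the same limits at the end points.  The difference extends by 0 to
a test function bounded by [(2 / s) sup |phi|], whose derivative is [phi' \o T] up
to an error of at most [(max |T''| / s^2 + 2 / (s h)) sup |phi|]; summing over the
branches and pairing with [F] bounds [\int P_T F phi' = \int F (phi' \o T)].
As [A < 1], the functions [P_(tau_(1,i)) f], and so their averages, have a common
bound [C].

The functions of variation at most [C] and of norm at most 1 form a compact set:
along an ultrafilter the integrals over the [n] cells of a partition into equal
intervals converge, and an [F] of variation at most [2 C] satisfies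
[|F|_1 <= 4 C / n + \sum_cells |\int_cell F|], so the ultrafilter is Cauchy in L^1.

For a Lipschitz function [r], the difference [\int f_n r - \int f_n (r \o tau)] is
the sum of a telescoping term O(1/n) and of the Cesaro mean of the integrals
[\int P_(tau_(1,i)) f (r \o tau_(i+1) - r \o tau)], which tend to 0 by the uniform
convergence of the maps.  Hence [\int g r = \int g (r \o tau)] for every
limit point [g].  As [r \o tau] is only used as a bounded function, [tau] need
not be continuous, and [r] may increase to the indicator of a ray; rays
determine the measure of density [g].
*)

Require Import Defs.
From HB Require Import structures.
From mathcomp Require Import all_boot all_order all_algebra.
From mathcomp Require Import all_classical all_reals all_analysis.
From mathcomp Require Import measurable_realfun ring lra.
Set Implicit Arguments.
Unset Strict Implicit.
Unset Printing Implicit Defensive.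

Import Order.TTheory GRing.Theory Num.Theory.
Import numFieldNormedType.Exports.

Local Open Scope classical_set_scope.
Local Open Scope ring_scope.

(** * Integrals against bounded functions *)

Section pairing.
Variable R : realType.
Notation mR := (measurableTypeR R).
Implicit Types (F G h : R -> R).

Definition integ F : Prop := mI.-integrable [set: mR] (EFin \o F).

(** The bound holds everywhere, not only almost everywhere, so that it survives composition with any
    measurable map, even before non-singularity is known. *)
Definition bmeas h : Prop :=
  measurable_fun [set: mR] (h : mR -> R) /\ exists K : R, forall x, `|h x| <= K.

Definition pair F h : R := \int[@mI R]_x (F x * h x).

Definition norm1 F : R := \int[@mI R]_x `|F x|.

Lemma mI_setT : (@mI R [set: mR] = 1)%E.
Proof.
rewrite /mI /mfrestr /mrestr setTI /I01 lebesgue_measure_itv/= lte_fin ltr01.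
by rewrite oppr0 adde0.
Qed.

Lemma integ_measurable F : integ F -> measurable_fun [set: mR] (F : mR -> R).
Proof. by move=> /(measurable_int mI)/measurable_EFinP. Qed.

Lemma bmeas_integ h : bmeas h -> integ h.
Proof.
move=> [mh [K hK]]; apply: measurable_bounded_integrable => //.
  by rewrite [X in (X < _)%E]mI_setT ltry.
by exists K; split; [exact: num_real|move=> x Kx y _; exact: le_trans (hK y) (ltW Kx)].
Qed.

Lemma integM F h : integ F -> bmeas h -> integ (F \* h).
Proof.
move=> iF [mh [K hK]].
have := @integrableMl _ _ _ mI setT measurableT (EFin \o F) h iF mh.
apply.
by exists K; split; [exact: num_real|move=> x Kx y _; exact: le_trans (hK y) (ltW Kx)].
Qed.

Lemma integD F G : integ F -> integ G -> integ (F \+ G).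
Proof. by move=> iF iG; exact: (integrableD measurableT iF iG). Qed.

Lemma integB F G : integ F -> integ G -> integ (F \- G).
Proof. by move=> iF iG; exact: (integrableB measurableT iF iG). Qed.

Lemma integZ c F : integ F -> integ (c \*o F).
Proof. by move=> iF; exact: (integrableZl measurableT c iF). Qed.

Lemma integ_norm F : integ F -> integ (fun x => `|F x|).
Proof. by move=> iF; exact: (integrable_norm iF). Qed.

Lemma bmeas_cst c : bmeas (cst c).
Proof. by split; [exact: measurable_cst|exists `|c| => x]. Qed.

Lemma bmeasD h1 h2 : bmeas h1 -> bmeas h2 -> bmeas (h1 \+ h2).
Proof.
move=> [m1 [K1 b1]] [m2 [K2 b2]]; split; first exact: measurable_funD.
by exists (K1 + K2) => x; rewrite (le_trans (ler_normD _ _))// lerD.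
Qed.

Lemma bmeasM h1 h2 : bmeas h1 -> bmeas h2 -> bmeas (h1 \* h2).
Proof.
move=> [m1 [K1 b1]] [m2 [K2 b2]]; split; first exact: measurable_funM.
by exists (K1 * K2) => x; rewrite normrM ler_pM.
Qed.

Lemma bmeasZ c h : bmeas h -> bmeas (c \*o h).
Proof. by move=> bh; apply: (bmeasM (bmeas_cst c) bh). Qed.

Lemma bmeasB h1 h2 : bmeas h1 -> bmeas h2 -> bmeas (h1 \- h2).
Proof.
move=> b1 /(bmeasZ (-1)) /(bmeasD b1) /=.
by congr bmeas; apply/funext => x /=; rewrite mulN1r.
Qed.

Lemma bmeas_sum n (h : nat -> R -> R) : (forall i, (i < n)%N -> bmeas (h i)) ->
  bmeas (fun x => \sum_(i < n) h i x).
Proof.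
elim: n => [_|n ih bh].
  by have := bmeas_cst 0; congr bmeas; apply/funext => x; rewrite big_ord0.
have := bmeasD (ih (fun i ni => bh i (ltnW ni))) (bh n (ltnSn n)).
by congr bmeas; apply/funext => x; rewrite big_ord_recr.
Qed.

Lemma bmeas_indic (A : set mR) : measurable A -> bmeas (\1_A).
Proof.
move=> mA; split; first exact: measurable_indic.
by exists 1 => x; rewrite indicE; case: (_ \in _); rewrite ?normr1 ?normr0.
Qed.

Lemma pairDr F h1 h2 : integ F -> bmeas h1 -> bmeas h2 ->
  pair F (h1 \+ h2) = pair F h1 + pair F h2.
Proof.
move=> iF b1 b2; rewrite /pair -RintegralD//; [|exact: integM..].
by apply: eq_Rintegral => x _ /=; rewrite mulrDr.
Qed.

Lemma pairZr F c h : integ F -> bmeas h -> pair F (c \*o h) = c * pair F h.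
Proof.
move=> iF bh; rewrite /pair -RintegralZl//; last exact: integM.
by apply: eq_Rintegral => x _ /=; rewrite mulrCA.
Qed.

Lemma pairBr F h1 h2 : integ F -> bmeas h1 -> bmeas h2 ->
  pair F (h1 \- h2) = pair F h1 - pair F h2.
Proof.
move=> iF b1 b2; rewrite /pair -RintegralB//; [|exact: integM..].
by apply: eq_Rintegral => x _ /=; rewrite mulrBr.
Qed.

Lemma pairDl F G h : integ F -> integ G -> bmeas h ->
  pair (F \+ G) h = pair F h + pair G h.
Proof.
move=> iF iG bh; rewrite /pair -RintegralD//; [|exact: integM..].
by apply: eq_Rintegral => x _ /=; rewrite mulrDl.
Qed.

Lemma pairBl F G h : integ F -> integ G -> bmeas h ->
  pair (F \- G) h = pair F h - pair G h.
Proof.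
move=> iF iG bh; rewrite /pair -RintegralB//; [|exact: integM..].
by apply: eq_Rintegral => x _ /=; rewrite mulrBl.
Qed.

Lemma pairZl F c h : integ F -> bmeas h -> pair (c \*o F) h = c * pair F h.
Proof.
move=> iF bh; rewrite /pair -RintegralZl//; last exact: integM.
by apply: eq_Rintegral => x _ /=; rewrite mulrA.
Qed.

Lemma pair_sumr F n (h : nat -> R -> R) :
  integ F -> (forall i, (i < n)%N -> bmeas (h i)) ->
  pair F (fun x => \sum_(i < n) h i x) = \sum_(i < n) pair F (h i).
Proof.
move=> iF; elim: n => [_|n ih bh].
  rewrite big_ord0 /pair; under eq_Rintegral do rewrite big_ord0 mulr0.
  by rewrite Rintegral_cst// mul0r.
rewrite big_ord_recr/= -ih; last by move=> i ni; exact/bh/ltnW.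
rewrite -pairDr; [|exact: iF|by apply: bmeas_sum => i ni; exact/bh/ltnW|exact: bh].
by apply: eq_Rintegral => x _ /=; rewrite big_ord_recr.
Qed.

Lemma norm1_ge0 F : 0 <= norm1 F.
Proof. by apply: Rintegral_ge0 => x _. Qed.

Lemma norm1_triangle F G H : integ F -> integ G -> integ H ->
  norm1 (F \- H) <= norm1 (F \- G) + norm1 (G \- H).
Proof.
move=> iF iG iH; rewrite /norm1 -RintegralD//; [|exact: integ_norm (integB _ _)..].
apply: le_Rintegral => //.
- by apply: integ_norm; exact: integB.
- by apply: integD; apply: integ_norm; exact: integB.
- by move=> x _ /=; rewrite (le_trans _ (ler_normD _ _))// addrA subrK.
Qed.

Lemma norm1C F G : norm1 (F \- G) = norm1 (G \- F).
Proof. by apply: eq_Rintegral => x _ /=; rewrite distrC. Qed.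

Lemma ae_mIS (P Q : R -> Prop) : (forall x, P x -> Q x) ->
  {ae @mI R, forall x, P x} -> {ae @mI R, forall x, Q x}.
Proof. exact: (@filterS mR). Qed.

Lemma ae_mIS2 (P Q S : R -> Prop) : (forall x, P x -> Q x -> S x) ->
  {ae @mI R, forall x, P x} -> {ae @mI R, forall x, Q x} ->
  {ae @mI R, forall x, S x}.
Proof. exact: (@filterS2 mR). Qed.

Lemma ae_I01 : {ae @mI R, forall x, I01 x}.
Proof.
exists (~` I01); split => //.
- by apply: measurableC; exact: measurable_I01.
- by have := @mI_setD0 R setT; rewrite setTD.
Qed.

Lemma ae_eq_Rintegral F G : integ F -> integ G -> F = G %[ae mI] ->
  \int[@mI R]_x F x = \int[@mI R]_x G x.
Proof.
move=> iF iG FG; rewrite /Rintegral; congr fine; apply: ae_eq_integral => //.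
- exact: (measurable_int mI).
- exact: (measurable_int mI).
- by apply: ae_mIS FG => x /(_ I) e _ /=; rewrite e.
Qed.

Lemma ae_le_Rintegral F G : integ F -> integ G ->
  {ae @mI R, forall x, F x <= G x} -> \int[@mI R]_x F x <= \int[@mI R]_x G x.
Proof.
move=> iF iG FG; move: (FG) => [N [mN N0 FGN]].
have b1 := bmeas_indic (measurableC mN).
(* Multiplying by the indicator of the complement of [N] keeps the integrals and makes the
   inequality hold at every point. *)
have E H : integ H -> \int[@mI R]_x H x = \int[@mI R]_x (H x * \1_(~` N) x).
  move=> iH; apply: ae_eq_Rintegral => //; first exact: integM.
  exists N; split => // x /= Hx; apply: contrapT => Nx; apply: Hx => _.
  by rewrite indicE mem_set// mulr1.
rewrite (E F)// (E G)//; apply: le_Rintegral => //; [exact: integM..|].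
move=> x _; rewrite indicE; have [/set_mem Nx|] := boolP (x \in ~` N).
  by rewrite !mulr1; apply: contrapT => FGx; apply: Nx; exact: FGN.
by rewrite !mulr0.
Qed.

Lemma pair_le_ae F h K : integ F -> bmeas h -> {ae @mI R, forall x, `|h x| <= K} ->
  `|pair F h| <= K * norm1 F.
Proof.
move=> iF bh hK; rewrite (le_trans (le_normr_Rintegral _ _))//; first exact: integM.
rewrite /norm1 -RintegralZl//; last exact: integ_norm.
apply: ae_le_Rintegral.
- by apply: integ_norm; exact: integM.
- by apply: integZ; exact: integ_norm.
- by apply: ae_mIS hK => x hx; rewrite normrM mulrC ler_wpM2r.
Qed.

Lemma pair_le F h K : integ F -> bmeas h -> (forall x, I01 x -> `|h x| <= K) ->
  `|pair F h| <= K * norm1 F.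
Proof. by move=> iF bh hK; apply: pair_le_ae => //; exact: ae_mIS ae_I01. Qed.

Lemma le_Rintegral_I01 F G : integ F -> integ G ->
  (forall x, I01 x -> F x <= G x) -> \int[@mI R]_x F x <= \int[@mI R]_x G x.
Proof.
by move=> iF iG FG; apply: ae_le_Rintegral => //; apply: ae_mIS ae_I01.
Qed.

Lemma eq_Rintegral_I01 F G : integ F -> integ G -> (forall x, I01 x -> F x = G x) ->
  \int[@mI R]_x F x = \int[@mI R]_x G x.
Proof.
by move=> iF iG FG; apply: ae_eq_Rintegral => //; apply: ae_mIS ae_I01 => x /FG.
Qed.

Lemma countable_seq (E : seq R) : countable [set` E].
Proof. exact/finite_set_countable/finite_seq. Qed.

Lemma measurable_seq (E : seq R) : measurable ([set` E] : set mR).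
Proof.
by apply: countable_measurable; [exact: measurable_set1|exact: countable_seq].
Qed.

Lemma ae_off_finite (E : seq R) : {ae @mI R, forall x, x \notin E}.
Proof.
exists [set` E]; split => /=.
- exact: measurable_seq.
- apply/eqP; rewrite eq_le measure_ge0 andbT; have mE := measurable_seq E.
  apply: (@le_trans _ _ (lebesgue_measure ([set` E] : set mR))).
    rewrite /mI /mfrestr /mrestr; apply: le_measure; rewrite ?inE//=.
    by apply: measurableI => //; exact: measurable_I01.
  by rewrite countable_lebesgue_measure0//; exact: countable_seq.
- by move=> x /= /negP; rewrite negbK.
Qed.

Lemma eq_pairl F G h : integ F -> integ G -> bmeas h ->
  F = G %[ae mI] -> pair F h = pair G h.
Proof.
move=> iF iG bh FG; apply: ae_eq_Rintegral; [exact: integM..|].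
by apply: ae_mIS FG => x e _ /=; rewrite e.
Qed.

Lemma eq_pairr F h1 h2 : integ F -> bmeas h1 -> bmeas h2 ->
  (forall x, I01 x -> h1 x = h2 x) -> pair F h1 = pair F h2.
Proof.
move=> iF b1 b2 h12; apply: eq_Rintegral_I01; [exact: integM..|].
by move=> x Ix; rewrite h12.
Qed.

Lemma norm1E F : integ F -> (\int[@mI R]_x `|(F x)%:E| = (norm1 F)%:E)%E.
Proof.
move=> iF; rewrite /norm1 /Rintegral fineK//.
exact: (integrable_fin_num measurableT (integ_norm iF)).
Qed.

End pairing.

(** * Variation by duality *)

Section test_functions.
Variable R : realType.
Notation mR := (measurableTypeR R).
Notation leb := (@lebesgue_measure R).
Implicit Types (F phi u p : R -> R) (E : seq R) (K M : R).

(** The derivative is a separate function [u], unconstrained on the finite set [E], so that sums and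
    cutoffs of test functions have explicit derivatives. *)
Definition smooth_off E phi u : Prop :=
  forall x, x \notin E -> is_derive x 1 phi (u x) /\ {for x, continuous u}.

Definition test phi u : Prop :=
  [/\ continuous phi, forall x, x \notin `]0, 1[ -> phi x = 0,
      exists K : R, forall x, `|u x| <= K & exists E, smooth_off E phi u].

(* The distributional derivative of [F] on [0, 1] is a measure of mass at most
   [C]; in contrast to [bounded_variation], this depends only on the class of [F]
   modulo equality almost everywhere. *)
Definition dualBV F (C : R) : Prop := forall phi u M,
  test phi u -> (forall x, `|phi x| <= M) -> `|pair F u| <= C * M.

Lemma continuous_off_measurable E u : (forall x, x \notin E -> {for x, continuous u}) ->
  measurable_fun [set: mR] (u : mR -> R).
Proof.
move=> cu; have mE := measurable_seq E.
have oE : open (~` [set` E] : set R).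
  apply: closed_openC; apply: accessible_finite_set_closed.1 (finite_seq _).
  exact/hausdorff_accessible/Rhausdorff.
rewrite -[X in measurable_fun X](setUv [set` E]).
apply/measurable_funU => //; first exact: measurableC.
split.
(* Inside the finite set every preimage is countable; on its open complement [u] is continuous. *)
- move=> _ Y mY; apply: countable_measurable; first exact: measurable_set1.
  apply: (@sub_countable _ _ _ [set` E]); last exact: countable_seq.
  by apply/subset_card_le; exact: subIsetl.
- apply: open_continuous_measurable_fun => //.
  by move=> x /set_mem/negP/cu.
Qed.

Lemma test_bmeas phi u : test phi u -> bmeas u.
Proof.
move=> [_ _ bu [E Eu]]; split => //.
by apply: (@continuous_off_measurable E) => x /Eu[].
Qed.

Lemma test0 : test (cst 0) (cst 0).
Proof.
split => //; first exact: cst_continuous.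
- by exists 0 => x /=; rewrite normr0.
- by exists [::] => x _; split; [exact: is_derive_cst|exact: cst_continuous].
Qed.

Lemma testD phi1 u1 phi2 u2 : test phi1 u1 -> test phi2 u2 ->
  test (phi1 \+ phi2) (u1 \+ u2).
Proof.
move=> [c1 z1 [K1 b1] [E1 s1]] [c2 z2 [K2 b2] [E2 s2]]; split.
- by move=> x; apply: continuousD; [exact: c1|exact: c2].
- by move=> x x01 /=; rewrite z1// z2// addr0.
- by exists (K1 + K2) => x; rewrite (le_trans (ler_normD _ _))// lerD.
- exists (E1 ++ E2) => x; rewrite mem_cat negb_or => /andP[/s1[d1 cu1] /s2[d2 cu2]].
  by split; [exact: is_deriveD|apply: continuousD].
Qed.

Lemma test_sum n (phi u : nat -> R -> R) : (forall i, (i < n)%N -> test (phi i) (u i)) ->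
  test (fun x => \sum_(i < n) phi i x) (fun x => \sum_(i < n) u i x).
Proof.
elim: n => [_|n ih h].
  by have := test0; congr test; apply/funext => x; rewrite big_ord0.
have := testD (ih (fun i ni => h i (ltnW ni))) (h n (ltnSn n)).
by congr test; apply/funext => x; rewrite big_ord_recr.
Qed.

Lemma itv_integrable (f : R -> R) K c d : measurable_fun [set: mR] (f : mR -> R) ->
  (forall x, x \in `[c, d] -> `|f x| <= K) ->
  leb.-integrable `[c, d] (EFin \o f).
Proof.
move=> mf bf; apply: measurable_bounded_integrable => //.
- by rewrite [X in (X < _)%E]lebesgue_measure_itv/=; case: ifP => _; rewrite -?EFinB ltry.
- exact: measurable_funTS.
- by exists K; split; [exact: num_real|move=> x Kx y ycd; exact: le_trans (bf _ ycd) (ltW Kx)].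
Qed.

Lemma Rintegral_split (f : R -> R) a c b : a <= c -> c <= b ->
  leb.-integrable `[a, b] (EFin \o f) ->
  \int[leb]_(x in `[a, b]) f x =
  \int[leb]_(x in `[a, c]) f x + \int[leb]_(x in `[c, b]) f x.
Proof.
move=> ac cb fi.
have icb : leb.-integrable `]c, b] (EFin \o f).
  by apply: integrableS fi => //; apply: subset_itvr; rewrite bnd_simp.
rewrite -(Rintegral_itv_obnd_cbnd icb) -(@Rintegral_itvB _ f (BLeft a) (BRight b) c)//.
by rewrite addrC subrK.
Qed.

(** Induction on [E]: the interval is split at an exceptional point that lies inside it. Without
    exceptional points, the difference of [phi] and the primitive of [u] has derivative 0, hence is
    constant by the mean value theorem. *)
Lemma FTC_off_finite E phi u K a b : a <= b -> continuous phi ->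
  measurable_fun [set: mR] (u : mR -> R) -> (forall x, `|u x| <= K) ->
  (forall x, x \in `]a, b[ -> x \notin E ->
    is_derive x 1 phi (u x) /\ {for x, continuous u}) ->
  \int[leb]_(x in `[a, b]) u x = phi b - phi a.
Proof.
move=> ab cphi mu bu; have ui c d : leb.-integrable `[c, d] (EFin \o u).
  exact: (@itv_integrable _ K).
elim: E a b ab => [|e E ih] a b ab du.
  move: ab; rewrite le_eqVlt => /predU1P[<-|ab].
    by rewrite set_itv1 Rintegral_set1 subrr.
  pose G x := \int[leb]_(t in `[a, x]) u t.
  have cG : {within `[a, b], continuous G}.
    exact: (parameterized_integral_continuous (ltW ab) (ui a b)).
  have dH x : x \in `]a, b[ -> is_derive x 1 (G \- phi) (cst 0 x).
    move=> xab; have [dphi cu] := du x xab isT.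
    move: (xab); rewrite in_itv/= => /andP[ax xb].
    have [dG G'] := continuous_FTC1_closed xb (ui a b) ax cu.
    rewrite /= -(subrr (u x)); apply: is_deriveB.
    by rewrite -G' derive1E; exact: derivableP.
  have cH : {within `[a, b], continuous (G \- phi)}.
    by move=> x; apply: continuousB; [exact: cG|exact: (continuous_subspaceT cphi)].
  have [c _] := MVT ab dH cH.
  rewrite mul0r /= => /eqP; rewrite subr_eq0 => /eqP.
  rewrite {2}/G set_itv1 Rintegral_set1 sub0r => /eqP.
  by rewrite subr_eq addrC => /eqP.
have [eab|neab] := boolP (e \in `]a, b[); last first.
  apply: ih => // x xab xE; apply: du => //; rewrite in_cons negb_or xE andbT.
  by apply: contraNneq neab => <-.
move: eab; rewrite in_itv/= => /andP[/ltW ae /ltW eb].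
rewrite (Rintegral_split ae eb)// (ih a e)// ?(ih e b)//; first by rewrite addrC addrA subrK.
- move=> x; rewrite in_itv/= => /andP[ex xb] xE; apply: du.
    by rewrite in_itv/= xb (le_lt_trans ae).
  by rewrite in_cons negb_or xE gt_eqF.
- move=> x; rewrite in_itv/= => /andP[ex xb] xE; apply: du.
    by rewrite in_itv/= ex (lt_le_trans xb).
  by rewrite in_cons negb_or xE lt_eqF.
Qed.

Lemma Rintegral_mIE (f : R -> R) : integ f ->
  \int[@mI R]_x f x = \int[leb]_(x in `[0, 1]) f x.
Proof.
move=> fi; rewrite /Rintegral; congr fine.
rewrite (@negligible_integral _ _ _ mI setT (~` @I01 R) (EFin \o f))//; last 2 first.
- by apply: measurableC; exact: measurable_I01.
- by have := @mI_setD0 R setT; rewrite setTD.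
rewrite setTD setCK; apply: eq_measure_integral => A mA AI.
by rewrite /= /mI /mfrestr /mrestr setIidl.
Qed.

(* Integration by parts against [dp]: on the cells of a uniform partition, [p] is
   replaced by its value at the right end, at a total cost of [K / N]. *)
Lemma monotone_dual_bound p phi u M : nondecreasing_fun p -> bmeas p -> test phi u ->
  (forall x, `|phi x| <= M) -> `|pair p u| <= (p 1 - p 0) * M.
Proof.
move=> ndp bp tu phiM.
have [mu [K bu]] := test_bmeas tu.
have K0 : 0 <= K by exact: le_trans (bu 0).
have [cphi z _ [E sE]] := tu.
have mp : measurable_fun [set: mR] (p : mR -> R) by exact: nondecreasing_measurable.
have mpu : measurable_fun [set: mR] ((fun x => p x * u x) : mR -> R).
  exact: measurable_funM.
have pb c d x : x \in `[c, d] -> `|p x| <= `|p c| + `|p d|.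
  rewrite in_itv/= => /andP[/ndp cx /ndp xd]; rewrite ler_norml; apply/andP; split.
    by have := lerNnormlW (lexx `|p c|); have := normr_ge0 (p d); lra.
  by have := ler_norm (p d); have := normr_ge0 (p c); lra.
have pui c d : leb.-integrable `[c, d] (EFin \o (fun x => p x * u x)).
  apply: (@itv_integrable _ ((`|p c| + `|p d|) * K)) => // x /pb px.
  by rewrite normrM ler_pM.
have ui c d : leb.-integrable `[c, d] (EFin \o u) by exact: (@itv_integrable _ K).
pose J c d := \int[leb]_(x in `[c, d]) (p x * u x).
(* On one cell write [p = (p - p d) + p d]. The integral of [(p - p d) u] is at most
   [(p d - p c) K (d - c)]; the rest is exact and differs from the boundary terms by
   [(p d - p c) phi c]. *)
have piece c d : c <= d ->
    `|J c d - (p d * phi d - p c * phi c)| <= (p d - p c) * (M + K * (d - c)).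
  move=> cd; have mcd : measurable (`[c, d]%classic : set mR) by exact: measurable_itv.
  pose r x := (p x - p d) * u x.
  have ri : leb.-integrable `[c, d] (EFin \o r).
    rewrite (_ : r = (fun x => p x * u x) \- (p d \*o u)); last first.
      by apply/funext => x; rewrite /r /= mulrBl.
    exact: (integrableB mcd (pui c d) (integrableZl mcd (p d) (ui c d))).
  have -> : J c d = \int[leb]_(x in `[c, d]) r x + p d * (phi d - phi c).
    rewrite -(@FTC_off_finite E phi u K c d)//; last by move=> x _; exact: sE.
    rewrite -(RintegralZl (p d) mcd (ui c d)).
    rewrite -(RintegralD mcd ri (integrableZl mcd (p d) (ui c d))).
    by apply: eq_Rintegral => x _; rewrite /r mulrBl subrK.
  have -> : \int[leb]_(x in `[c, d]) r x + p d * (phi d - phi c) -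
      (p d * phi d - p c * phi c) =
      \int[leb]_(x in `[c, d]) r x - (p d - p c) * phi c by ring.
  rewrite (le_trans (ler_normB _ _))// mulrDr addrC lerD//.
    by rewrite normrM ger0_norm ?subr_ge0 ?ndp// ler_wpM2l// subr_ge0 ndp.
  rewrite (le_trans (le_normr_Rintegral _ _))//.
  have -> : (p d - p c) * (K * (d - c)) = \int[leb]_(x in `[c, d]) ((p d - p c) * K).
    rewrite Rintegral_cst// [X in fine X]lebesgue_measure_itv/= lte_fin.
    move: cd; rewrite le_eqVlt => /predU1P[->|cd]; first by rewrite ltxx !subrr !mul0r.
    by rewrite cd /= mulrA.
  apply: le_Rintegral => //.
  - exact: integrable_norm.
  - by apply: (@itv_integrable _ (`|(p d - p c) * K|)) => //; exact: measurable_cst.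
  - move=> x /=; rewrite in_itv/= => /andP[/ndp cx /ndp xd].
    by rewrite normrM ler_pM// distrC ger0_norm ?subr_ge0// lerD2l lerN2.
have main N : `|pair p u| <= (p 1 - p 0) * (M + K / N.+1%:R).
  pose c k : R := k%:R / N.+1%:R.
  have c0 : c 0%N = 0 by rewrite /c mul0r.
  have cN : c N.+1 = 1 by rewrite /c divff.
  have cS k : c k <= c k.+1 by rewrite ler_wpM2r// ler_nat.
  have c_ge0 k : 0 <= c k by rewrite divr_ge0.
  have dc k : c k.+1 - c k = N.+1%:R^-1 by rewrite /c -mulrBl -natrB// subSnn mul1r.
  (* Both the boundary terms and the increments of [p] telescope over the cells; at the last cell
     the boundary terms vanish, since [phi] is 0 at 0 and at 1. *)
  have H k : `|J 0 (c k) - (p (c k) * phi (c k) - p 0 * phi 0)| <=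
      (p (c k) - p 0) * (M + K / N.+1%:R).
    elim: k => [|k ih].
      by rewrite c0 /J set_itv1 Rintegral_set1 !subrr mul0r normr0.
    have := lerD ih (piece _ _ (cS k)); rewrite dc -mulrDl.
    rewrite [X in _ <= X * _ -> _]addrC addrA subrK.
    apply: le_trans; rewrite (le_trans _ (ler_normD _ _))//.
    rewrite /J (@Rintegral_split _ 0 (c k) (c k.+1))// le_eqVlt; apply/orP; left.
    by apply/eqP; congr (`| _ |); ring.
  have := H N.+1; rewrite cN !z ?in_itv/= ?ltxx ?andbF// !mulr0 !subr0.
  suff -> : pair p u = J 0 1 by [].
  apply: Rintegral_mIE.
  by apply: integM; [exact: bmeas_integ|exact: test_bmeas tu].
apply/ler_addgt0Pr => e e0.
pose N := Num.bound ((p 1 - p 0) * K / e).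
have : (p 1 - p 0) * K / e < N.+1%:R.
  by rewrite (lt_trans (archi_boundP _)) ?ltr_nat// divr_ge0 ?mulr_ge0 ?subr_ge0 ?ndp// ltW.
rewrite ltr_pdivrMr// => /ltW KN.
by rewrite (le_trans (main N))// mulrDr lerD2l mulrA ler_pdivrMr// [leRHS]mulrC.
Qed.

(** [monotone_dual_bound] applies to both parts of the Jordan decomposition; the constant is the sum
    of their increments over [0, 1]. *)
Lemma bounded_variation_dualBV F : integ F -> bounded_variation 0 1 F ->
  exists C, dualBV F C.
Proof.
move=> iF bvF.
(* The Jordan decomposition of [F] is only monotone on [0, 1]; composing with [cl]
   makes it monotone on [R]. *)
pose cl (x : R) : R := Num.max 0 (Num.min 1 x).
have cl01 x : cl x \in `[0, 1].
  by rewrite /cl in_itv/= le_max lexx ge_max ler01 ge_min lexx.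
have clE x : x \in `[0, 1] -> cl x = x.
  by rewrite in_itv/= /cl => /andP[x0 x1]; rewrite min_r// max_r.
have cl_nd : nondecreasing_fun cl.
  by move=> x y xy; rewrite /cl le_max2// le_min2.
pose q G : R -> R := (fine \o neg_tv 0 G) \o cl.
have qP G : bounded_variation 0 1 G -> nondecreasing_fun (q G) /\ bmeas (q G).
  move=> bvG; have ndq : nondecreasing_fun (q G).
    by move=> x y xy; apply: (fine_neg_tv_nondecreasing bvG) => //; exact: cl_nd.
  split=> //; split; first exact: nondecreasing_measurable.
  have qcl x : q G x = q G (cl x) by rewrite /q /= (clE (cl x) (cl01 x)).
  exists (`|q G 0| + `|q G 1|) => x; rewrite qcl.
  have /andP[c0 c1] : 0 <= cl x <= 1 by have := cl01 x; rewrite in_itv.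
  have := ndq _ _ c0; have := ndq _ _ c1.
  have := lerNnormlW (lexx `|q G 0|); have := ler_norm (q G 1).
  have := normr_ge0 (q G 0); have := normr_ge0 (q G 1).
  by rewrite ler_norml; lra.
(* On [0, 1], [q F] is the negative part of the decomposition of [F], and [q (\- F)] the positive
   one. *)
have [ndn bn] := qP F bvF.
have [ndp bp] := qP (\- F) (bounded_variationN bvF).
exists ((q (\- F) 1 - q (\- F) 0) + (q F 1 - q F 0)) => phi u M tu phiM.
have bu := test_bmeas tu.
have -> : pair F u = pair (q (\- F)) u - pair (q F) u.
  rewrite -pairBl//; [|exact: bmeas_integ..].
  apply: eq_Rintegral_I01; first exact: integM.
    by apply: integM => //; exact/bmeas_integ/bmeasB.
  move=> x x01; congr (_ * _).
  by rewrite (bounded_variation_pos_neg_tvE bvF) //= /q /= clE.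
rewrite (le_trans (ler_normB _ _))// mulrDl lerD//;
  exact: (monotone_dual_bound _ _ tu phiM).
Qed.

End test_functions.

(** * The Lasota-Yorke inequality *)

Section pieces.
Variable R : realType.
Implicit Types (E : seq R) (a b x lam D : R) (f g psi v phi u T : R -> R).

(** The interval is open, so the values of [f] at [a] and [b], arbitrary in the applications, do not
    enter. *)
Definition cutoff a b f x : R := if x \in `]a, b[ then f x else 0.

Lemma near_cutoff a b f x : x \in `]a, b[ -> \near x, f x = cutoff a b f x.
Proof.
by move=> xab; near do rewrite /cutoff ifT//; exact: near_in_itvoo.
Unshelve. all: by end_near. Qed.

Lemma near_cutoff0 a b f x : x \notin `[a, b] -> \near x, 0 = cutoff a b f x.
Proof.
rewrite in_itv/= negb_and -!ltNge => /orP[xa|bx].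
  have := @near_in_itvNyo R a x; rewrite in_itv/= => /(_ xa).
  apply: filterS => y; rewrite in_itv/= => ya.
  by rewrite /cutoff in_itv/= ltNge (ltW ya).
have := @near_in_itvoy R b x; rewrite in_itv/= andbT => /(_ bx).
apply: filterS => y; rewrite in_itv/= andbT => yb.
by rewrite /cutoff in_itv/= [X in _ && X]ltNge (ltW yb) andbF.
Qed.

Lemma continuous_near_eq f g x : {for x, continuous f} -> (\near x, f x = g x) ->
  {for x, continuous g}.
Proof.
move=> cf fg; rewrite /prop_for /continuous_at -(nbhs_singleton fg).
exact: cvg_trans (near_eq_cvg fg) cf.
Qed.

Lemma cutoff_continuous_at a b f x : x \in `]a, b[ -> {for x, continuous f} ->
  {for x, continuous (cutoff a b f)}.
Proof. by move=> xab cf; exact: continuous_near_eq cf (near_cutoff _ xab). Qed.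

Lemma cutoff_continuous_out a b f x : x \notin `[a, b] ->
  {for x, continuous (cutoff a b f)}.
Proof.
move=> xab; apply: continuous_near_eq (near_cutoff0 _ xab).
exact: cst_continuous.
Qed.

Lemma continuous_cutoff a b f : a < b -> {in `]a, b[, continuous f} ->
  f x @[x --> a^'+] --> (0 : R) -> f x @[x --> b^'-] --> (0 : R) ->
  continuous (cutoff a b f).
Proof.
move=> ab cf fa fb x.
have [xab|] := boolP (x \in `]a, b[); first exact: cutoff_continuous_at (cf _ xab).
have [->{x} _|xa] := eqVneq x a.
  apply/left_right_continuousP; rewrite {2 4}/cutoff in_itv/= ltxx/=; split.
    apply: cvg_near_cst; near=> y.
    by rewrite /cutoff in_itv/= ltNge (_ : (y <= a) = true)//; apply/ltW.
  apply: cvg_trans fa; apply: near_eq_cvg; near=> y.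
  by rewrite /cutoff ifT// in_itv/=; apply/andP; split.
have [->{x xa} _|xb] := eqVneq x b.
  apply/left_right_continuousP; rewrite {2 4}/cutoff in_itv/= ltxx andbF/=; split.
    apply: cvg_trans fb; apply: near_eq_cvg; near=> y.
    by rewrite /cutoff ifT// in_itv/=; apply/andP; split.
  apply: cvg_near_cst; near=> y.
  by rewrite /cutoff in_itv/= [X in _ && X]ltNge (_ : (b <= y) = true) ?andbF//; apply/ltW.
rewrite in_itv/= => xab; apply: cutoff_continuous_out; rewrite in_itv/=.
by rewrite !le_eqVlt eq_sym (negbTE xa) (negbTE xb).
Unshelve. all: by end_near. Qed.

Lemma test_cutoff E a b psi v (K : R) : 0 <= a -> a < b -> b <= 1 ->
  {in `]a, b[, continuous psi} ->
  psi x @[x --> a^'+] --> (0 : R) -> psi x @[x --> b^'-] --> (0 : R) ->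
  (forall x, x \in `]a, b[ -> `|v x| <= K) ->
  (forall x, x \in `]a, b[ -> x \notin E ->
    is_derive x 1 psi (v x) /\ {for x, continuous v}) ->
  test (cutoff a b psi) (cutoff a b v).
Proof.
move=> a0 ab b1 cpsi psia psib bv dpsi; split.
- exact: continuous_cutoff.
- move=> x; rewrite /cutoff; case: ifPn => // xab /negP[]; move: xab.
  by rewrite !in_itv/= => /andP[/(le_lt_trans a0) -> /lt_le_trans ->].
- exists `|K| => x; rewrite /cutoff; case: ifPn => [/bv vK|_].
    exact: le_trans vK (ler_norm _).
  by rewrite normr0.
(* The end points join the exceptional set, since the derivative may jump there. *)
- exists [:: a, b & E] => x; rewrite !in_cons !negb_or => /and3P[xa xb xE].
  have [xab|xab] := boolP (x \in `]a, b[).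
    have [d c] := dpsi x xab xE; split; last exact: cutoff_continuous_at.
    rewrite /cutoff xab.
    exact: (near_eq_is_derive (near_cutoff psi xab) d).
  have {}xab : x \notin `[a, b].
    move: xab; rewrite !in_itv/=.
    by rewrite !le_eqVlt eq_sym (negbTE xa) (negbTE xb).
  split; last exact: cutoff_continuous_out.
  rewrite /cutoff ifF; last first.
    by apply: contraNF xab; exact: subset_itv_oo_cc.
  exact: (near_eq_is_derive (near_cutoff0 psi xab) (is_derive_cst _ _ _)).
Qed.

Lemma le_cvg_norm (F : set_system R) (FF : ProperFilter F) f (l M : R) :
  f x @[x --> F] --> l -> (\forall x \near F, `|f x| <= M) -> `|l| <= M.
Proof. by move=> /cvg_norm fl fM; exact: cvgr_to_le fl fM. Qed.

Section transfer_piece.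
Variables (a b lam D : R) (T T1 T2 : R -> R).
Hypotheses (a0 : 0 <= a) (ab : a < b) (b1 : b <= 1) (lam0 : 0 < lam).
Hypothesis dT : forall x, x \in `]a, b[ -> is_derive x 1 T (T1 x).
Hypothesis dT1 : forall x, x \in `]a, b[ -> is_derive x 1 T1 (T2 x).
Hypothesis cT2 : {in `]a, b[, continuous T2}.
Hypothesis lamT1 : forall x, x \in `]a, b[ -> lam <= `|T1 x|.
Hypothesis T2D : forall x, x \in `]a, b[ -> `|T2 x| <= D.
Hypotheses (Ta : cvg (T x @[x --> a^'+])) (Tb : cvg (T x @[x --> b^'-])).
Hypotheses (T1a : cvg (T1 x @[x --> a^'+])) (T1b : cvg (T1 x @[x --> b^'-])).

Let der_cont f (df x : R) : is_derive x 1 f df -> {for x, continuous f}.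
Proof. by move=> [df' _]; apply: differentiable_continuous; exact/derivable1_diffP. Qed.

(** Two equal values would produce a zero of [T1] by the mean value theorem. *)
Lemma expanding_inj : {in `]a, b[ &, injective T}.
Proof.
suff H x y : x \in `]a, b[ -> y \in `]a, b[ -> x < y -> T x <> T y.
  move=> x y xab yab Txy; apply/eqP; case: ltgtP => // xy.
    by case: (H _ _ xab yab xy).
  by case: (H _ _ yab xab xy).
rewrite !in_itv/= => /andP[ax xb] /andP[ay yb] xy Txy.
have sub z : z \in `[x, y] -> z \in `]a, b[.
  by rewrite !in_itv/= => /andP[/(lt_le_trans ax) -> /le_lt_trans ->].
have [c cxy] := @MVT R T T1 x y xy (fun z zxy => dT (sub z (subset_itv_oo_cc zxy)))
  (derivable_within_continuous (fun z zxy => @ex_derive _ _ _ _ _ _ _ (dT (sub z zxy)))).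
move=> /eqP; rewrite Txy subrr eq_sym mulf_eq0 subr_eq0 (gt_eqF xy) orbF => /eqP T1c.
have := lamT1 (sub c (subset_itv_oo_cc cxy)).
by rewrite T1c normr0 leNgt lam0.
Qed.

(** The quotient [psi = phi (T x) / T1 x] has derivative [u (T x) - phi (T x) * T2 x / T1 x ^+ 2];
    the last term accounts for [D / lam ^+ 2]. The limits of [psi] at the end points are at most
    [M / lam] in absolute value, so the affine correction has slope at most [2 M / (lam (b - a))].
    The bound on [w] adds [M / lam] for [psi] and [M / lam] for the correction. *)
Lemma transfer_piece phi u (M : R) : test phi u -> (forall x, `|phi x| <= M) ->
  exists w v, [/\ test w v,
    forall x, x \notin `]a, b[ -> w x = 0 /\ v x = 0,
    forall x, `|w x| <= 2 / lam * M &
    forall x, x \in `]a, b[ ->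
      `|v x - u (T x)| <= (D / lam ^+ 2 + 2 / (lam * (b - a))) * M].
Proof.
move=> tu phiM; have [cphi _ [K uK] [E uE]] := tu.
have M0 : 0 <= M by exact: le_trans (phiM 0).
(* [l] interpolates the limits of [psi] at [a] and [b], so that [psi - l], extended
   by 0, is continuous. *)
pose psi x := phi (T x) / T1 x.
have T1_neq0 x : x \in `]a, b[ -> T1 x != 0.
  by move=> /lamT1 lx; rewrite -normr_gt0 (lt_le_trans lam0).
have psiM x : x \in `]a, b[ -> `|psi x| <= M / lam.
  move=> xab; rewrite normrM normfV ler_pM// ?invr_ge0// lef_pV2 ?posrE//.
    exact: lamT1.
  by rewrite normr_gt0 T1_neq0.
have neara : \forall x \near a^'+, x \in `]a, b[.
  by near=> x; rewrite in_itv/=; apply/andP; split=> //; near: x; exact: nbhs_right_lt.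
have nearb : \forall x \near b^'-, x \in `]a, b[.
  by near=> x; rewrite in_itv/=; apply/andP; split=> //; near: x; exact: nbhs_left_gt.
have psi_cvg (F : set_system R) (FF : ProperFilter F) :
    (\forall x \near F, x \in `]a, b[) -> cvg (T x @[x --> F]) ->
    cvg (T1 x @[x --> F]) -> exists2 L : R, psi x @[x --> F] --> L & `|L| <= M / lam.
  move=> nearF /cvg_ex[t Tt] /cvg_ex[t1 T1t].
  (* The lower bound [lam] on [|T1|] passes to the limit, so the quotient converges. *)
  have t1_neq0 : t1 != 0.
    rewrite -normr_gt0 (lt_le_trans lam0)//.
    by apply: cvgr_to_ge (cvg_norm T1t) _; apply: filterS nearF; exact: lamT1.
  exists (phi t / t1).
    by apply: cvgM; [exact: (cvg_comp _ _ Tt (cphi t))|exact: cvgV].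
  apply: (@le_cvg_norm F FF psi); last by apply: filterS nearF.
  by apply: cvgM; [exact: (cvg_comp _ _ Tt (cphi t))|exact: cvgV].
have [La psia LaM] := psi_cvg _ _ neara Ta T1a.
have [Lb psib LbM] := psi_cvg _ _ nearb Tb T1b.
have ba0 : 0 < b - a by rewrite subr_gt0.
pose c := (Lb - La) / (b - a).
pose l x := La + c * (x - a).
have dl x : is_derive x 1 l c.
  rewrite /l; apply: is_derive_eq; rewrite /GRing.scale/=; ring.
have cl : continuous l by move=> x; exact: der_cont (dl x).
(* On the piece [l x] is a convex combination of [La] and [Lb], and inherits their bound. *)
have lM x : x \in `]a, b[ -> `|l x| <= M / lam.
  rewrite in_itv/= => /andP[ax xb].
  have -> : l x = (La * (b - x) + Lb * (x - a)) / (b - a).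
    by rewrite /l /c; field; rewrite gt_eqF.
  rewrite normrM normfV (gtr0_norm ba0) ler_pdivrMr//.
  have -> : M / lam * (b - a) = M / lam * (b - x) + M / lam * (x - a) by ring.
  rewrite (le_trans (ler_normD _ _))// lerD// normrM.
    by rewrite (@gtr0_norm _ (b - x)) ?subr_gt0// ler_wpM2r// subr_ge0 ltW.
  by rewrite (@gtr0_norm _ (x - a)) ?subr_gt0// ler_wpM2r// subr_ge0 ltW.
pose v x := u (T x) - phi (T x) * T2 x / T1 x ^+ 2 - c.
(* [E'] collects the points of the piece that [T] maps into [E]: by injectivity each point of [E]
   has at most one preimage there. The default 0 only adds a point to a finite exceptional set. *)
pose T' e := xget 0 [set x : R | (x \in `]a, b[) /\ T x = e].
pose E' := map T' E.
have E'P x : x \in `]a, b[ -> x \notin E' -> T x \notin E.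
  move=> xab; apply: contraNN => TxE; apply/mapP; exists (T x) => //; rewrite /T'.
  case: xgetP => [y _ /= [yab yx]|/(_ x)/= []//].
  exact: expanding_inj.
have cT x : x \in `]a, b[ -> {for x, continuous T} by move=> /dT/der_cont.
have cT1 x : x \in `]a, b[ -> {for x, continuous T1} by move=> /dT1/der_cont.
have cphiT x : x \in `]a, b[ -> {for x, continuous (phi \o T)}.
  by move=> xab; apply: continuous_comp; [exact: cT|exact: cphi].
have rM x : x \in `]a, b[ ->
    `|phi (T x) * T2 x / T1 x ^+ 2 + c| <= (D / lam ^+ 2 + 2 / (lam * (b - a))) * M.
  move=> xab; rewrite (le_trans (ler_normD _ _))// mulrDl lerD//.
    have -> : D / lam ^+ 2 * M = M * D / lam ^+ 2 by ring.
    rewrite !normrM normfV normrX ler_pM ?mulr_ge0 ?invr_ge0 ?exprn_ge0//.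
      by rewrite ler_pM// T2D.
    rewrite lef_pV2 ?posrE ?exprn_gt0 ?normr_gt0 ?T1_neq0// lerXn2r ?nnegrE ?(ltW lam0)//.
    exact: lamT1.
  rewrite /c normrM normfV (gtr0_norm ba0) ler_pdivrMr//.
  have -> : 2 / (lam * (b - a)) * M * (b - a) = M / lam + M / lam.
    by field; rewrite !gt_eqF.
  by rewrite (le_trans (ler_normB _ _))// lerD.
exists (cutoff a b (psi \- l)), (cutoff a b v); split.
- apply: (@test_cutoff E' _ _ _ _ (K + (D / lam ^+ 2 + 2 / (lam * (b - a))) * M) a0 ab b1).
  + move=> x xab; apply: continuousB; last exact: cl.
    by apply: continuousM; [exact: cphiT|apply: continuousV; [exact: T1_neq0|exact: cT1]].
  + rewrite -(subrr La); apply: cvgB => //.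
    have -> : La = l a by rewrite /l subrr mulr0 addr0.
    exact: cvg_at_right_filter (cl a).
  + rewrite -(subrr Lb); apply: cvgB => //.
    have -> : Lb = l b by rewrite /l /c; field; rewrite gt_eqF.
    exact: cvg_at_left_filter (cl b).
  + move=> x xab; rewrite /v -addrA -opprD (le_trans (ler_normB _ _))// lerD// rM//.
  + move=> x xab /(E'P x xab) /uE[dphi cu]; split.
      have dphiT := is_derive1_comp dphi (dT xab).
      have dV := is_deriveV (T1_neq0 x xab) (dT1 xab).
      have dd : is_derive x 1 (psi \- l) _ := is_deriveB (is_deriveM dphiT dV) (dl x).
      apply: (is_derive_eq dd).
      by rewrite /v /GRing.scale/=; field; exact: T1_neq0.
    have cuT : {for x, continuous (u \o T)}.
      by apply: continuous_comp; [exact: cT|exact: cu].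
    apply: continuousB; last exact: cst_continuous.
    apply: continuousB; first exact: cuT.
    apply: continuousM.
      by apply: continuousM; [exact: cphiT|exact: cT2].
    apply: continuousV; first by rewrite expf_neq0// T1_neq0.
    by apply: (@continuous_comp _ _ _ T1 (fun y => y ^+ 2)); [exact: cT1|exact: exprn_continuous].
- by move=> x xab; rewrite /cutoff (negbTE xab).
- move=> x; rewrite /cutoff; case: ifPn => [xab|_]; last first.
    by rewrite normr0 mulr_ge0// divr_ge0// ltW.
  rewrite (le_trans (ler_normB _ _))//.
  have -> : 2 / lam * M = M / lam + M / lam by ring.
  by rewrite lerD ?psiM ?lM.
- move=> x xab; rewrite /cutoff xab -normrN.
  have -> : - (v x - u (T x)) = phi (T x) * T2 x / T1 x ^+ 2 + c by rewrite /v; ring.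
  exact: rM.
Unshelve. all: by end_near. Qed.

End transfer_piece.
End pieces.

(** * The inequality for a whole piecewise expanding map *)

Section Lasota_Yorke.
Variable R : realType.
Notation mR := (measurableTypeR R).
Implicit Types (F G T f h phi u : R -> R) (s : seq R) (C M lam a b x : R).

(* [G] is a version of [P_T F]. *)
Definition transfer T F G : Prop :=
  forall h, bmeas h -> pair G h = pair F (h \o (T \_ I01)).

Lemma bmeas_comp h (S : R -> R) : bmeas h ->
  measurable_fun [set: mR] (S : mR -> mR) -> bmeas (h \o S).
Proof.
by move=> [mh [K hK]] mS; split; [exact: measurableT_comp|exists K => x; exact: hK].
Qed.

Lemma node_lt s i : itv_partition 0 1 s -> (i < size s)%N -> node s i < node s i.+1.
Proof. by move=> [/(pathP (0 : R)) /(_ i) + _]; exact. Qed.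

Lemma node_le s i j : itv_partition 0 1 s -> (i <= j <= size s)%N ->
  node s i <= node s j.
Proof.
move=> [ps _] /andP[ij js].
have st : sorted <=%O (0 :: s) by apply: (@sub_path _ <%O) ps => x y /ltW.
apply: (sorted_leq_nth le_trans le_refl 0 st) => //.
by rewrite inE/= ltnS (leq_trans ij).
Qed.

Lemma node01 s i : itv_partition 0 1 s -> (i <= size s)%N -> 0 <= node s i <= 1.
Proof.
move=> ips is_; have [_ /eqP l1] := ips.
have -> : (1 : R) = node s (size s) by rewrite -l1 /node (last_nth 0).
by rewrite -{1}[0]/(node s 0) !node_le// ?is_ ?leqnn// leq0n.
Qed.

Lemma in_piece s x : itv_partition 0 1 s -> I01 x -> x \notin 0 :: s ->
  exists2 i, (i < size s)%N & x \in `]node s i, node s i.+1[.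
Proof.
move=> [ps /eqP ls]; rewrite /I01/= in_itv/= /node.
suff gen t a : path <%R a t -> last a t = 1 -> a <= x <= 1 -> x \notin a :: t ->
    exists2 i, (i < size t)%N & x \in `]nth 0 (a :: t) i, nth 0 t i[ by exact: gen.
elim: t a {s ps ls} => [|b s ih] a /=.
  by move=> _ <- /andP[ax xa]; rewrite inE eq_le ax xa.
move=> /andP[ab ps] ls /andP[ax x1]; rewrite !in_cons !negb_or => /and3P[xa xb xs].
have [xltb|blex] := ltP x b.
  by exists 0%N => //=; rewrite in_itv/= xltb andbT lt_neqAle eq_sym xa.
have [||i si xi] := ih b ps ls; first by rewrite blex x1.
  by rewrite in_cons negb_or xb.
by exists i.+1.
Qed.

Lemma piece_disjoint s i j x : itv_partition 0 1 s ->
  (i < size s)%N -> (j < size s)%N ->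
  x \in `]node s i, node s i.+1[ -> x \in `]node s j, node s j.+1[ -> i = j.
Proof.
move=> ips.
suff H (a b : nat) : (a < b)%N -> (b < size s)%N -> x \in `]node s a, node s a.+1[ ->
    x \in `]node s b, node s b.+1[ -> False.
  move=> si sj xi xj; case: (ltngtP i j) => // ij; exfalso.
    exact: H ij sj xi xj.
  exact: H ij si xj xi.
move=> ab bs; rewrite !in_itv/= => /andP[_ xa] /andP[bx _].
have : node s a.+1 <= node s b by rewrite node_le// ab ltnW.
by rewrite leNgt (lt_trans bx).
Qed.

Lemma mesh_min_gt0 s : itv_partition 0 1 s -> 0 < mesh_min s.
Proof.
move=> ips; rewrite /mesh_min; apply/bigmin_gtP; split => // i _.
by rewrite lebesgue_measure_itv/= lte_fin node_lt// -EFinB/= subr_gt0 node_lt.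
Qed.

Lemma mesh_min_le s i : itv_partition 0 1 s -> (i < size s)%N ->
  mesh_min s <= node s i.+1 - node s i.
Proof.
move=> ips si; rewrite /mesh_min (le_trans (bigmin_le _ (Ordinal si) _))//=.
by rewrite lebesgue_measure_itv/= lte_fin node_lt// -EFinB.
Qed.

Lemma derivable1_is_derive f x : derivable f x 1 -> is_derive x 1 f (derive1 f x).
Proof. by rewrite derive1E; exact: derivableP. Qed.

(** Extended by its one-sided limits, [f] is continuous on the compact interval [[a, b]]. *)
Lemma cvg_bounded_oo f a b : a < b -> {in `]a, b[, continuous f} ->
  cvg (f x @[x --> a^'+]) -> cvg (f x @[x --> b^'-]) ->
  exists K : R, forall x, x \in `]a, b[ -> `|f x| <= K.
Proof.
move=> ab cf /cvg_ex[/= la fa] /cvg_ex[/= lb fb].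
pose g x := if x == a then la else if x == b then lb else f x.
have gE x : x \in `]a, b[ -> g x = f x.
  by rewrite in_itv/= => /andP[ax xb]; rewrite /g gt_eqF// lt_eqF.
have cg : {within `[a, b], continuous g}.
  apply/continuous_within_itvP => //; split.
  - move=> x xab; apply: continuous_near_eq (cf _ xab) _.
    near=> y; rewrite gE//; near: y; exact: near_in_itvoo.
  - rewrite {2}/g eqxx; apply: cvg_trans fa; apply: near_eq_cvg; near=> y.
    by rewrite gE// in_itv/=; apply/andP; split.
  - rewrite {2}/g eqxx gt_eqF//; apply: cvg_trans fb; apply: near_eq_cvg; near=> y.
    by rewrite gE// in_itv/=; apply/andP; split.
have /compact_bounded[K [_ Kb]] := continuous_compact cg (@segment_compact _ a b).
exists (K + 1) => x xab; rewrite -gE//; apply: (Kb (K + 1)); first by rewrite ltrDl.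
by exists x => //=; exact: subset_itv_oo_cc.
Unshelve. all: by end_near. Qed.

(** The supremum in [max_derive2] is an upper bound only once its set is known to be bounded; the
    bound is the sum over the pieces of those given by [cvg_bounded_oo]. *)
Lemma max_derive2_ge T s lam i x : piecewise_expanding_with T s lam ->
  (i < size s)%N -> x \in `]node s i, node s i.+1[ ->
  `|derive1n 2 T x| <= max_derive2 T s.
Proof.
move=> [ips _ pT] si xi; apply: ub_le_sup; last by exists i, x.
have /choice[K HK] : forall j, exists K : R, (j < size s)%N ->
    forall y, y \in `]node s j, node s j.+1[ -> `|derive1n 2 T y| <= K.
  move=> j; have [sj|] := boolP (j < size s)%N; last by exists 0.
  have [_ [_ cT2] _ [ca cb] _] := pT j sj.
  by have [K] := cvg_bounded_oo (node_lt ips sj) cT2 ca cb; exists K.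
exists (\sum_(j < size s) `|K j|) => _ [j [y [sj yj ->]]].
rewrite (le_trans (HK j sj y yj))// (le_trans (ler_norm _))//.
by rewrite (bigD1 (Ordinal sj))//= lerDl sumr_ge0.
Qed.

Lemma max_derive2_ge0 T s lam : piecewise_expanding_with T s lam ->
  0 <= max_derive2 T s.
Proof.
move=> pe; have [ips _ _] := pe.
have s0 : (0 < size s)%N.
  rewrite lt0n size_eq0; apply/negP => /eqP s0; move: ips; rewrite s0 => -[_ /=].
  by rewrite eq_sym oner_eq0.
have := node_lt ips s0 => ab.
apply: le_trans (max_derive2_ge pe s0 (_ : (node s 0 + node s 1) / 2 \in _)) => //.
by rewrite in_itv/=; lra.
Qed.

(** [piecewise_expanding_with] provides limits at the end points for the derivatives; those of [T]
    itself, required by [transfer_piece], come from monotonicity and boundedness. *)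
Lemma monotone_cvg T a b : a < b ->
  ({in `]a, b[ &, nondecreasing_fun T} \/ {in `]a, b[ &, nonincreasing_fun T}) ->
  (forall x, x \in `]a, b[ -> T x \in `[0, 1]) ->
  cvg (T x @[x --> a^'+]) /\ cvg (T x @[x --> b^'-]).
Proof.
suff H (f : R -> R) : a < b -> {in `]a, b[ &, nondecreasing_fun f} ->
    (forall x, x \in `]a, b[ -> `|f x| <= 1) ->
    cvg (f x @[x --> a^'+]) /\ cvg (f x @[x --> b^'-]).
  move=> ab mT T01.
  have T1 x : x \in `]a, b[ -> `|T x| <= 1.
    by move=> /T01; rewrite in_itv/= => /andP[T0 ?]; rewrite ger0_norm.
  case: mT => mT; first exact: H.
  have [||cN1 cN2] := H (\- T) ab.
  - by move=> x y xab yab xy; rewrite lerN2 mT.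
  - by move=> x /T1; rewrite normrN.
  - by split; [rewrite -(is_cvgNE T)|rewrite -(is_cvgNE T)].
move=> ab ndf f1; split.
  apply: nondecreasing_at_right_is_cvgr.
    near=> x => y z yx zx; apply: ndf.
      by apply: subset_itvl yx; rewrite bnd_simp; near: x; exact: nbhs_right_le.
    by apply: subset_itvl zx; rewrite bnd_simp; near: x; exact: nbhs_right_le.
  near=> x; exists (- 1) => _ [y /= yx <-]; apply: lerNnormlW; apply: f1.
  by apply: subset_itvl yx; rewrite bnd_simp; near: x; exact: nbhs_right_le.
apply: nondecreasing_at_left_is_cvgr.
  near=> x => y z yx zx; apply: ndf.
    by apply: subset_itvr yx; rewrite bnd_simp; near: x; exact: nbhs_left_ge.
  by apply: subset_itvr zx; rewrite bnd_simp; near: x; exact: nbhs_left_ge.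
near=> x; exists 1 => _ [y /= yx <-]; apply: le_trans (ler_norm _) _; apply: f1.
by apply: subset_itvr yx; rewrite bnd_simp; near: x; exact: nbhs_left_ge.
Unshelve. all: by end_near. Qed.

Lemma sum_ord_single n i (c : nat -> R) : (i < n)%N ->
  (forall j, (j < n)%N -> j != i -> c j = 0) -> \sum_(j < n) c j = c i.
Proof.
move=> ni c0; rewrite (bigD1 (Ordinal ni))//= big1 ?addr0// => j ji.
by apply: c0.
Qed.

(** The branches have disjoint interiors, so the sum [W] of the functions from [transfer_piece]
    keeps the bound of a single one. In [pair F (u \o T) = pair F V - pair F (V - u \o T)], the
    first term is controlled by the variation of [F] and gives [LY_A]; the second is controlled by
    the norm of [F] and gives [LY_B]. *)
Lemma Lasota_Yorke_dual T s lam F G C :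
  piecewise_expanding_with T s lam -> set_fun I01 I01 T ->
  measurable_fun [set: mR] (T \_ I01 : mR -> mR) ->
  integ F -> transfer T F G -> dualBV F C ->
  dualBV G (LY_A lam * C + LY_B T s lam * norm1 F).
Proof.
move=> pe TI mT iF trT bvF phi u M tu phiM.
have [ips lam1 pT] := pe.
have lam0 : 0 < lam by exact: lt_trans lam1.
have M0 : 0 <= M by exact: le_trans (phiM 0).
have h0 := mesh_min_gt0 ips.
set h := mesh_min s in h0 *; set D := max_derive2 T s.
have D0 : 0 <= D := max_derive2_ge0 pe.
have sub i x : (i < size s)%N -> x \in `]node s i, node s i.+1[ -> I01 x.
  move=> si; have /andP[a0 _] := node01 ips (ltnW si).
  have /andP[_ b1] := node01 ips si.
  by rewrite /I01/= !in_itv/= => /andP[/ltW/(le_trans a0) -> /ltW/le_trans ->].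
have /choice[wv HW] : forall i, exists wv : (R -> R) * (R -> R), (i < size s)%N ->
    [/\ test wv.1 wv.2,
      forall x, x \notin `]node s i, node s i.+1[ -> wv.1 x = 0 /\ wv.2 x = 0,
      forall x, `|wv.1 x| <= 2 / lam * M &
      forall x, x \in `]node s i, node s i.+1[ ->
      `|wv.2 x - u (T x)| <= (D / lam ^+ 2 + 2 / (lam * h)) * M].
  move=> i; have [si|] := boolP (i < size s)%N; last by exists (cst 0, cst 0).
  have ab := node_lt ips si.
  have /andP[a0 _] := node01 ips (ltnW si); have /andP[_ b1] := node01 ips si.
  have [mono [dT cT2] [ca cb] _ lT] := pT i si.
  have T01 x : x \in `]node s i, node s i.+1[ -> T x \in `[0, 1].
    by move=> /(sub _ _ si)/TI.
  have [Ta Tb] := monotone_cvg ab mono T01.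
  have [w [v [tw w0 wM vM]]] := transfer_piece a0 ab b1 lam0
    (fun x xab => derivable1_is_derive (dT x xab).1)
    (fun x xab => derivable1_is_derive (dT x xab).2) cT2 lT
    (fun x => max_derive2_ge pe si) Ta Tb ca cb tu phiM.
  exists (w, v) => _; split => // x xab; rewrite (le_trans (vM x xab))//.
  rewrite ler_wpM2r// lerD2l// ler_pM2l// lef_pV2 ?posrE ?mulr_gt0 ?subr_gt0//.
  by rewrite ler_pM2l// mesh_min_le.
pose W x := \sum_(i < size s) (wv i).1 x.
pose V x := \sum_(i < size s) (wv i).2 x.
have tWV : test W V.
  apply: (test_sum (phi := fun i => (wv i).1) (u := fun i => (wv i).2)).
  by move=> i /HW[].
have WVE i x : (i < size s)%N -> x \in `]node s i, node s i.+1[ ->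
    W x = (wv i).1 x /\ V x = (wv i).2 x.
  move=> si xi; have z j : (j < size s)%N -> j != i ->
      (wv j).1 x = 0 /\ (wv j).2 x = 0.
    move=> sj ji; have [_ + _ _] := HW j sj; apply.
    apply: contra ji => xj; apply/eqP.
    exact: (piece_disjoint ips sj si xj xi).
  split; [apply: (sum_ord_single (c := fun j => (wv j).1 x) si)|
          apply: (sum_ord_single (c := fun j => (wv j).2 x) si)] => j sj ji.
    exact: (z j sj ji).1.
  exact: (z j sj ji).2.
have lM0 : 0 <= 2 / lam * M by rewrite mulr_ge0// divr_ge0// ltW.
have WM x : `|W x| <= 2 / lam * M.
  have [[i [si xi]]|nx] := pselect (exists i, (i < size s)%N /\ x \in `]node s i, node s i.+1[).
    by rewrite (WVE i x si xi).1; have [_ _ + _] := HW i si; exact.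
  rewrite /W big1 ?normr0// => i _.
  have [_ + _ _] := HW i (ltn_ord i) => /(_ x) []// .
  by apply/negP => xi; apply: nx; exists i.
have bu := test_bmeas tu; have bV := test_bmeas tWV.
have buT : bmeas (u \o (T \_ I01)) by exact: bmeas_comp.
rewrite trT//.
have -> : pair F (u \o (T \_ I01)) = pair F V - pair F (V \- (u \o (T \_ I01))).
  by rewrite pairBr// opprB addrC subrK.
rewrite (le_trans (ler_normB _ _))// mulrDl lerD//.
  have -> : LY_A lam * C * M = C * (2 / lam * M) by rewrite /LY_A; ring.
  exact: (bvF _ _ _ tWV WM).
(* The estimate on [V - u \o T] holds off the partition points, hence almost everywhere. *)
apply: (@le_trans _ _ ((D / lam ^+ 2 + 2 / (lam * h)) * M * norm1 F)).
  apply: pair_le_ae => //; first exact: bmeasB.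
  apply: ae_mIS2 (ae_I01 R) (ae_off_finite (0 :: s)) => x Ix xs.
  have [i si xi] := in_piece ips Ix xs.
  rewrite /= (WVE i x si xi).2 patchE mem_set//.
  by have [_ _ _ +] := HW i si; exact.
(* As [lam > 1], a factor [lam] may be dropped from each denominator, which leads to [LY_B]. *)
rewrite mulrAC ler_wpM2r// ler_wpM2r ?norm1_ge0// /LY_B -/D -/h lerD//.
  rewrite ler_wpM2l// lef_pV2 ?posrE ?exprn_gt0//.
  by rewrite expr2 ler_peMr ?ltW.
by rewrite ler_wpM2l// lef_pV2 ?posrE ?mulr_gt0// ler_peMl ?ltW.
Qed.

End Lasota_Yorke.

(** * Non-singularity and the transfer operator *)

Section transfer_operator.
Variable R : realType.
Notation mR := (measurableTypeR R).
Notation leb := (@lebesgue_measure R).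
Implicit Types (F G T f h : R -> R) (s : seq R) (lam a b x : R) (A S : set R).

Lemma restrict_measurable T s lam : piecewise_expanding_with T s lam ->
  measurable_fun [set: mR] (T \_ I01 : mR -> mR).
Proof.
move=> [ips _ pT]; apply: (@continuous_off_measurable _ (0 :: 1 :: s)) => x.
rewrite !in_cons !negb_or => /and3P[x0 x1 xs].
have [x01|x01] := boolP (x \in `]0, 1[).
  have Ix : I01 x by exact: subset_itv_oo_cc.
  have [|i si xi] := in_piece ips Ix; first by rewrite in_cons negb_or x0.
  have [_ [dT _] _ _ _] := pT i si.
  have cT : {for x, continuous T}.
    exact/differentiable_continuous/derivable1_diffP/(dT x xi).1.
  apply: continuous_near_eq cT _; near=> y; rewrite patchE mem_set//.
  apply: subset_itv_oo_cc; near: y; exact: near_in_itvoo.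
have {}x01 : x \notin `[0, 1].
  by move: x01; rewrite !in_itv/= !le_eqVlt eq_sym (negbTE x0) (negbTE x1).
have c0 : {for x, continuous (cst 0 : R -> R)} by exact: cst_continuous.
apply: continuous_near_eq c0 _.
have oI : open (~` (`[0, 1]%classic : set R)) by apply: closed_openC; exact: itv_closed.
have : nbhs x (~` (`[0, 1]%classic : set R)).
  by apply: open_nbhs_nbhs; split => //; exact/negP.
by apply: filterS => y yI; rewrite patchE memNset.
Unshelve. all: by end_near. Qed.

Lemma restrict_preimage T (A : set mR) :
  measurable_fun [set: mR] (T \_ I01 : mR -> mR) -> measurable A ->
  measurable (I01 `&` T @^-1` A : set mR).
Proof.
move=> mT mA; rewrite (_ : _ `&` _ = I01 `&` (T \_ I01) @^-1` A).
  apply: measurableI; first exact: measurable_I01.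
  by rewrite -[X in measurable X]setTI; exact: mT.
by apply/seteqP; split => x /= [Ix]; rewrite patchE mem_set.
Qed.

(* [T] pulls an interval of length [l] back into an interval of length [2 l]. *)
Lemma expanding_null S A T : (forall x y, S x -> S y -> `|x - y| <= `|T x - T y|) ->
  leb A = 0%E -> measurable (S `&` T @^-1` A : set mR) -> leb (S `&` T @^-1` A) = 0%E.
Proof.
move=> expT A0 mSA; apply/eqP; rewrite eq_le measure_ge0 andbT.
apply/lee_addgt0Pr => e e0; rewrite add0e.
(* By definition of the outer measure, [A] has a countable cover by half-open intervals of total
   length below [e / 2]; the pullback doubles the lengths. *)
have /ereal_inf_lt[z [/= J [mJ AJ] Jz ze]] : (leb A < (e / 2)%:E)%E.
  by rewrite A0 lte_fin divr_gt0.
have /choice[N HN] : forall k, exists N : set mR, [/\ measurable N,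
    S `&` T @^-1` J k `<=` N & (leb N <= 2%:E * wlength idfun (J k))%E].
  move=> k; have [P0|/set0P[p [Sp Jp]]] := eqVneq (S `&` T @^-1` J k) set0.
    exists set0; split => //; first by rewrite P0.
    by rewrite measure0 mule_ge0// wlength_ge0.
  have /ocitvP[J0|[[a b] /= ab Jab]] := mJ k; first by move: Jp; rewrite /= J0.
  exists `[p - (b - a), p + (b - a)]%classic; split.
  - exact: measurable_itv.
  - move=> y [Sy Jy]; have := expT _ _ Sy Sp.
    move: Jp Jy; rewrite /= Jab/= !in_itv/= => /andP[aTp Tpb] /andP[aTy Tyb].
    move=> /le_trans yp; have /yp : `|T y - T p| <= b - a.
      by rewrite ler_norml; apply/andP; split; lra.
    by rewrite ler_norml => /andP[? ?]; apply/andP; split; lra.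
  - rewrite [X in (X <= _)%E]lebesgue_measure_itv/= lte_fin.
    rewrite Jab wlength_itv/= lte_fin ab -EFinB -EFinM.
    by case: ifP => _; rewrite lee_fin; lra.
have mN k : measurable (N k) by have [] := HN k.
apply: (@le_trans _ _ (\sum_(k <oo) leb (N k))%E).
  apply: measure_sigma_subadditive => //.
  move=> x [Sx /AJ[k _ Jk]]; exists k => //.
  by have [_ + _] := HN k; apply.
apply: (@le_trans _ _ (\sum_(k <oo) (2%:E * wlength idfun (J k)))%E).
  by apply: lee_nneseries => k _ //; have [] := HN k.
rewrite nneseriesZl//.
rewrite Jz; apply: le_trans (lee_wpmul2l _ (ltW ze)) _ => //.
by rewrite -EFinM lee_fin; lra.
Qed.

Definition nonsingular T : Prop := forall A : set mR, measurable A ->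
  mI A = 0%E -> mI (I01 `&` T @^-1` A) = 0%E.

Lemma mI_E (A : set mR) : mI A = leb (A `&` I01).
Proof. by []. Qed.

(** By the mean value theorem and [lam > 1], distances do not decrease on a piece, so
    [expanding_null] applies to each piece; the partition points form a null set. *)
Lemma expanding_nonsingular T s lam : piecewise_expanding_with T s lam ->
  set_fun I01 I01 T -> nonsingular T.
Proof.
move=> pe TI A mA A0; have mT := restrict_measurable pe.
have [ips lam1 pT] := pe.
have mAI : measurable (A `&` I01 : set mR).
  by apply: measurableI => //; exact: measurable_I01.
(* Only the part of [A] inside [I01] is Lebesgue-null, hence the intersection. The pieces are
   continued by the empty set to form a countable family. *)
pose B i := if (i < size s)%N then
  `]node s i, node s i.+1[%classic `&` T @^-1` (A `&` I01) else set0.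
have BI i : (i < size s)%N -> `]node s i, node s i.+1[%classic `<=` I01.
  move=> si x; have /andP[a0 _] := node01 ips (ltnW si).
  have /andP[_ b1] := node01 ips si.
  by rewrite /I01/= !in_itv/= => /andP[/ltW/(le_trans a0) -> /ltW/le_trans ->].
have nB i : leb.-negligible (B i).
  rewrite /B; case: ifPn => si; last exact: negligible_set0.
  set Bi := (X in leb.-negligible X).
  have mB : measurable (Bi : set mR).
    rewrite (_ : Bi = `]node s i, node s i.+1[%classic `&` (T \_ I01) @^-1` (A `&` I01)).
      apply: measurableI; first exact: measurable_itv.
      by rewrite -[X in measurable X]setTI; exact: mT.
    apply/seteqP; split => x /= [xi]; rewrite patchE mem_set//; exact: BI xi.
  exists Bi; split => //; apply: expanding_null => //.
  have [_ [dT _] _ _ lT] := pT i si.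
  suff H x y : x \in `]node s i, node s i.+1[ -> y \in `]node s i, node s i.+1[ ->
      x < y -> `|x - y| <= `|T x - T y|.
    move=> x y xi yi; case: (ltgtP x y) => [xy|yx|->]; first exact: H.
      by rewrite distrC (distrC (T x)); exact: H.
    by rewrite !subrr.
  rewrite !in_itv/= => /andP[ax xb] /andP[ay yb] xy.
  have sub z : z \in `[x, y] -> z \in `]node s i, node s i.+1[.
    by rewrite !in_itv/= => /andP[/(lt_le_trans ax) -> /le_lt_trans ->].
  have [c cxy e] := @MVT R T (derive1 T) x y xy
    (fun z zxy => derivable1_is_derive (dT z (sub z (subset_itv_oo_cc zxy))).1)
    (derivable_within_continuous (fun z zxy => (dT z (sub z zxy)).1)).
  rewrite distrC (distrC (T x)) e normrM ler_peMl//.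
  exact: le_trans (ltW lam1) (lT c (sub c (subset_itv_oo_cc cxy))).
have mX := restrict_preimage mT mA.
rewrite mI_E setIAC setIid; apply: measure_negligible => //.
apply: (@negligibleS _ _ _ leb ((\bigcup_i B i) `|` [set` 0 :: s])).
  move=> x [Ix Ax]; have [xs|xs] := boolP (x \in 0 :: s); [by right|left].
  have [i si xi] := in_piece ips Ix xs.
  by exists i => //; rewrite /B si; split => //=; split => //; exact: TI.
apply: negligibleU; first exact: negligible_bigcup.
exists [set` 0 :: s]; split => //; first exact: measurable_seq.
by apply: countable_lebesgue_measure0; exact: countable_seq.
Qed.

(** The sum counts the positive integers up to [y], so it is the floor of [y]. *)
Lemma count_le_bounds (y : R) n : 0 <= y -> y <= n%:R ->
  y - 1 <= \sum_(k < n) (k.+1%:R <= y)%R%:R <= y.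
Proof.
move=> y0 yn; set c := \sum_(_ < _) _.
(* The induction on [n] needs [y] unrestricted: either all [n] terms count, or the bounds hold
   already. *)
suff [H1 H2] : (n%:R <= y -> c = n%:R) /\ (y < n%:R -> y - 1 <= c <= y).
  have [ny|/H2//] := leP n%:R y.
  by rewrite H1//; apply/andP; split; lra.
rewrite {}/c {yn}; elim: n => [|n [ih1 ih2]].
  by rewrite big_ord0; split => // /lt_le_trans/(_ y0); rewrite ltxx.
rewrite big_ord_recr/=; split => [ny|yn].
  have n1 : (n%:R : R) <= n.+1%:R by rewrite ler_nat.
  by rewrite ny ih1 ?(le_trans _ ny)// natr1.
rewrite (_ : (n.+1%:R <= y) = false) ?addr0; last by rewrite leNgt yn.
  have [ny|/ih2//] := leP n%:R y.
rewrite ih1// ny andbT.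
by move: yn; rewrite -natr1; lra.
Qed.

Lemma pair_indic F (A : set mR) : measurable A -> integ F ->
  pair F (\1_A) = \int[@mI R]_(x in A) F x.
Proof.
move=> mA iF; rewrite Rintegral_mkcond; apply: eq_Rintegral => x _.
by rewrite patchE indicE; case: ifPn => _; rewrite ?mulr1 ?mulr0.
Qed.

(** Linearity and uniform approximation extend the identity from indicators to functions with values
    in [0, 1], and an affine change of values then reaches all bounded functions. *)
Lemma transfer_of_sets T F G : integ F -> integ G ->
  measurable_fun [set: mR] (T \_ I01 : mR -> mR) ->
  (forall A : set mR, measurable A ->
    \int[@mI R]_(x in A) G x = \int[@mI R]_(x in I01 `&` T @^-1` A) F x) ->
  transfer T F G.
Proof.
move=> iF iG mT FG.
have indic (A : set mR) : measurable A -> pair G \1_A = pair F (\1_A \o (T \_ I01)).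
  move=> mA; rewrite pair_indic// FG// -pair_indic//; last first.
    exact: restrict_preimage.
  apply: eq_pairr => //.
  - by apply: bmeas_indic; exact: restrict_preimage.
  - by apply: bmeas_comp => //; exact: bmeas_indic.
  - by move=> x Ix; rewrite /= patchE (mem_set Ix) !indicE in_setI (mem_set Ix).
(* A function with values in [0, 1] is at distance at most [1 / n] from the mean of
   the indicators of its superlevel sets [k / n <= h]. *)
have unit h : bmeas h -> (forall x, 0 <= h x <= 1) -> pair G h = pair F (h \o (T \_ I01)).
  move=> bh h01; have [mh _] := bh.
  have mA t : measurable ([set x | t <= h x] : set mR).
    rewrite (_ : [set x | _] = h @^-1` `[t, +oo[%classic).
      by rewrite -[X in measurable X]setTI; apply: mh => //; exact: measurable_itv.
    by apply/seteqP; split => x /=; rewrite in_itv/= andbT.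
  pose hs n (k : nat) : R -> R := \1_[set x | k.+1%:R / n.+1%:R <= h x].
  pose hn n : R -> R := n.+1%:R^-1 \*o (fun x => \sum_(k < n.+1) hs n k x).
  have bhs n k : bmeas (hs n k) by apply: bmeas_indic; exact: mA.
  have bsum n : bmeas (fun x => \sum_(k < n.+1) hs n k x).
    exact: (bmeas_sum (h := hs n)).
  have bhn n : bmeas (hn n) by exact: bmeasZ.
  have hhn n x : `|h x - hn n x| <= n.+1%:R^-1.
    have n0 : 0 < n.+1%:R :> R by [].
    have /andP[h0 h1] := h01 x.
    have := @count_le_bounds (n.+1%:R * h x) n.+1.
    rewrite mulr_ge0// -[leRHS]mulr1 ler_pM2l// => /(_ isT h1).
    have -> : \sum_(k < n.+1) (k.+1%:R <= n.+1%:R * h x)%R%:R = n.+1%:R * hn n x.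
      rewrite /hn/= mulVKf//; apply: eq_bigr => k _; rewrite /hs indicE/=.
      rewrite (_ : (x \in _) = (k.+1%:R / n.+1%:R <= h x)).
        by rewrite ler_pdivrMr// mulrC.
      by apply/idP/idP; rewrite inE.
    move=> /andP[l1 l2]; rewrite ler_norml -(ler_pM2l n0) -[X in _ && X](ler_pM2l n0).
    by rewrite mulrN mulfV// mulrBr; apply/andP; split; lra.
  have key n : `|pair G h - pair F (h \o (T \_ I01))| <=
      n.+1%:R^-1 * (norm1 G + norm1 F).
    have bF k : bmeas (hs n k \o (T \_ I01)) by exact: bmeas_comp.
    have -> : pair G h - pair F (h \o (T \_ I01)) =
        pair G (h \- hn n) - pair F ((h \- hn n) \o (T \_ I01)).
      rewrite pairBr// (_ : _ \o _ = (h \o (T \_ I01)) \- (hn n \o (T \_ I01)))//.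
      rewrite pairBr//; [|exact: bmeas_comp..].
      suff -> : pair G (hn n) = pair F (hn n \o (T \_ I01)) by ring.
      rewrite /hn pairZr// (pair_sumr (h := hs n))//.
      rewrite [RHS](_ : _ = pair F (n.+1%:R^-1 \*o
        (fun x => \sum_(k < n.+1) (hs n k \o (T \_ I01)) x)))//.
      rewrite pairZr//; last exact: (bmeas_sum (h := fun k => hs n k \o (T \_ I01))).
      rewrite (pair_sumr (h := fun k => hs n k \o (T \_ I01)))//.
      by congr (_ * _); apply: eq_bigr => k _; apply: indic; exact: mA.
    rewrite (le_trans (ler_normB _ _))// mulrDr lerD//.
      by apply: (pair_le iG (bmeasB bh (bhn n))) => x _; exact: hhn.
    by apply: (pair_le iF (bmeas_comp (bmeasB bh (bhn n)) mT)) => x _; exact: hhn.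
  apply/eqP; rewrite -subr_eq0 -normr_le0; apply/ler_addgt0Pr => e e0.
  set c := norm1 G + norm1 F in key.
  have c0 : 0 <= c by rewrite addr_ge0// norm1_ge0.
  pose N := Num.bound (c / e).
  rewrite add0r (le_trans (key N))// ler_pdivrMl// -ler_pdivrMr//.
  by rewrite ltW// (lt_trans (archi_boundP _)) ?ltr_nat// divr_ge0// ltW.
move=> h bh; have [_ [K hK]] := bh.
have K0 : 0 <= K by exact: le_trans (hK 0).
(* [h'] is [h] rescaled into [0, 1]; [K + 1] instead of [K] keeps the factor [c] positive. *)
pose c := 2 * (K + 1); have c0 : 0 < c by rewrite /c; lra.
pose h' : R -> R := c^-1 \*o (h \+ cst (K + 1)).
have bh' : bmeas h' by apply: bmeasZ; apply: bmeasD => //; exact: bmeas_cst.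
have h'01 x : 0 <= h' x <= 1.
  rewrite /h' /=; have := hK x; rewrite ler_norml => /andP[? ?].
  rewrite mulr_ge0 ?invr_ge0 ?(ltW c0)//=; last lra.
  by rewrite ler_pdivrMl// mulr1 /c; lra.
have hE : h = (c \*o h') \- cst (K + 1).
  by apply/funext => x; rewrite /h' /= mulVKf ?gt_eqF// addrK.
have bc := bmeas_cst (K + 1).
rewrite {1}hE pairBr//; last exact: bmeasZ.
rewrite pairZr// (unit h')//.
have -> : pair F (h \o (T \_ I01)) =
    pair F ((c \*o (h' \o (T \_ I01))) \- (cst (K + 1))).
  by rewrite {1}hE.
have bh'T : bmeas (h' \o (T \_ I01)) by exact: bmeas_comp.
rewrite pairBr//; last exact: bmeasZ.
rewrite pairZr//; congr (_ - _).
have one : pair G (cst 1) = pair F (cst 1 \o (T \_ I01)).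
  by apply: unit => [|x]; [exact: bmeas_cst|rewrite /= ler01 lexx].
have cE : cst (K + 1) = (K + 1) \*o (cst 1 : R -> R).
  by apply/funext => x /=; rewrite mulr1.
have b1 := bmeas_cst (1 : R).
by rewrite cE !pairZr// one.
Qed.

(** Tested against its own sign [h], [G] gives its norm, while [h \o T] is still bounded by 1. *)
Lemma transfer_norm1 T F G : integ F -> integ G ->
  measurable_fun [set: mR] (T \_ I01 : mR -> mR) ->
  transfer T F G -> norm1 G <= norm1 F.
Proof.
move=> iF iG mT trT.
have mA : measurable ([set x | 0 <= G x] : set mR).
  rewrite (_ : [set x | _] = G @^-1` `[0, +oo[%classic).
    rewrite -[X in measurable X]setTI.
    exact: (integ_measurable iG measurableT (measurable_itv _)).
  by apply/seteqP; split => x /=; rewrite in_itv/= andbT.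
pose h : R -> R := (2 \*o \1_[set x | 0 <= G x]) \- cst 1.
have bh : bmeas h.
  by apply: bmeasB; [apply: bmeasZ; exact: bmeas_indic|exact: bmeas_cst].
have hE x : h x = if 0 <= G x then 1 else - 1.
  rewrite /h/= indicE (_ : (x \in _) = (0 <= G x)); last first.
    by apply/idP/idP; rewrite inE.
  by case: ifP => _ /=; lra.
have -> : norm1 G = pair G h.
  apply: eq_Rintegral => x _; rewrite hE; case: ifPn => [G0|].
    by rewrite mulr1 ger0_norm.
  by rewrite -ltNge => G0; rewrite mulrN1 ltr0_norm.
rewrite trT//; apply: le_trans (ler_norm _) _.
rewrite -[leRHS]mul1r; apply: pair_le => //; first exact: bmeas_comp.
by move=> x _; rewrite /= hE; case: ifP => _; rewrite ?normrN normr1.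
Qed.

End transfer_operator.

(** * Compactness in L^1 *)

Section dual_norm.
Variable R : realType.
Notation mR := (measurableTypeR R).
Notation leb := (@lebesgue_measure R).
Implicit Types (F G g w : R -> R) (s : seq R) (C c e a b x : R).

Lemma ge0_integral_mIE (f : mR -> \bar R) : measurable_fun [set: mR] f ->
  (forall x, (0 <= f x)%E) ->
  (\int[@mI R]_x f x = \int[leb]_(x in `[0%R, 1%R]) f x)%E.
Proof.
move=> mf f0.
rewrite (@ge0_negligible_integral _ _ _ mI setT (~` @I01 R) f)//; last 2 first.
- by apply: measurableC; exact: measurable_I01.
- by have := @mI_setD0 R setT; rewrite setTD.
rewrite setTD setCK; apply: eq_measure_integral => A mA AI.
by rewrite /= /mI /mfrestr /mrestr setIidl.
Qed.

Lemma integP F : measurable_fun [set: mR] (F : mR -> R) ->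
  integ F <-> leb.-integrable `[0, 1] (EFin \o F).
Proof.
move=> mF; have mEF : measurable_fun [set: mR] (EFin \o F) by exact/measurable_EFinP.
have E : (\int[@mI R]_x `|(EFin \o F) x| = \int[leb]_(x in `[0%R, 1%R]) `|(EFin \o F) x|)%E.
  by apply: ge0_integral_mIE => //; exact: measurableT_comp.
split=> /integrableP[_ fin]; apply/integrableP; split.
- exact: measurable_funTS.
- by rewrite -E.
- exact: mEF.
- by rewrite E.
Qed.

Lemma continuous_integ w : continuous w -> integ w.
Proof.
move=> cw; apply/integP; first exact: continuous_measurable_fun.
apply: continuous_compact_integrable; first exact: segment_compact.
exact: continuous_subspaceT.
Qed.

Lemma continuous_dense F e : integ F -> 0 < e ->
  exists2 w : R -> R, continuous w & norm1 (F \- w) < e.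
Proof.
move=> iF e0; have mF := integ_measurable iF.
have [|w_ [cw iw]] := @approximation_continuous_integrable R `[0, 1]%classic F
    (measurable_itv _) _ ((integP mF).1 iF).
  by rewrite [X in (X < _)%E]lebesgue_measure_itv/= lte_fin ltr01 -EFinB ltry.
move=> /fine_cvgP[_ /cvgrPdist_lt/(_ e e0)[n _ /(_ n (leqnn n))]].
rewrite /= sub0r normrN => wn; exists (w_ n) => //.
apply: le_lt_trans wn; apply: le_trans (ler_norm _).
have iFw : integ (F \- w_ n) by apply: integB => //; exact: continuous_integ.
rewrite /norm1 /Rintegral ge0_integral_mIE//.
exact: (measurable_int mI (integ_norm iFw)).
Qed.

(** Continuous functions suffice to recover the norm; continuity is what makes their primitives
    differentiable in [test_mean]. *)
Lemma norm1_le_dual F c : integ F ->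
  (forall g, continuous g -> (forall x, `|g x| <= 1) -> `|pair F g| <= c) ->
  norm1 F <= c.
Proof.
move=> iF gc; apply/ler_addgt0Pr => e e0.
(* One third each for the two uses of [norm1 (F \- w)], in [H1] and [H3], and for the smoothing of
   the sign in [H2]. *)
have e3 : 0 < e / 3 by rewrite divr_gt0.
have [w cw Fw] := continuous_dense iF e3.
have iw := continuous_integ cw.
have iFw := integB iF iw.
(* A continuous approximation of the sign of [w]. *)
pose g x : R := w x / (`|w x| + e / 3).
have d0 x : 0 < `|w x| + e / 3 by rewrite ltr_wpDl.
have cg : continuous g.
  move=> x; have cwx : {for x, continuous w} by exact: cw.
  have cd : {for x, continuous (fun y => `|w y| + e / 3)}.
    apply: continuousD; last exact: cst_continuous.
    by apply: continuous_comp; [exact: cw|exact: norm_continuous].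
  by apply: (continuousM cwx); apply: (continuousV _ cd); rewrite gt_eqF.
have g1 x : `|g x| <= 1.
  rewrite normrM normfV (gtr0_norm (d0 x)) ler_pdivrMr// mul1r lerDl ltW//.
have bg : bmeas g by split; [exact: continuous_measurable_fun|exists 1].
have H1 : norm1 F <= norm1 (F \- w) + norm1 w.
  have i0 : integ (cst 0 : R -> R) by exact/bmeas_integ/bmeas_cst.
  have := norm1_triangle iF iw i0.
  rewrite (_ : norm1 (F \- cst 0) = norm1 F)//; last first.
    by apply: eq_Rintegral => x _ /=; rewrite subr0.
  by rewrite (_ : norm1 (w \- cst 0) = norm1 w)//; apply: eq_Rintegral => x _ /=; rewrite subr0.
have H2 : norm1 w <= pair w g + e / 3.
  have -> : e / 3 = \int[@mI R]_x (e / 3) by rewrite Rintegral_cst// [X in fine X]mI_setT mulr1.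
  rewrite /pair -RintegralD//; [|exact: integM|exact/bmeas_integ/bmeas_cst].
  apply: le_Rintegral => //; first exact: integ_norm.
    by apply: integD; [exact: integM|exact/bmeas_integ/bmeas_cst].
  move=> x _; rewrite /g mulrA -expr2 -(@ler_pM2r _ (`|w x| + e / 3))//.
  rewrite mulrDl divfK ?gt_eqF// -real_normK ?num_real//.
  by have := normr_ge0 (w x); nra.
have H3 : pair w g <= c + norm1 (F \- w).
  have -> : pair w g = pair F g - pair (F \- w) g by rewrite pairBl// opprB addrC subrK.
  rewrite lerD//; first exact: le_trans (ler_norm _) (gc g cg g1).
  apply: le_trans (ler_norm _) _; rewrite normrN -[leRHS]mul1r.
  by apply: (pair_le iFw bg) => x _; exact: g1.
by move: H1 H2 H3 Fw; lra.
Qed.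

(* [m] is the mean of [g] on [a, b], and [psi] a primitive of [g - m]. *)
Lemma test_mean g a b : 0 <= a -> a < b -> b <= 1 -> continuous g ->
  (forall x, `|g x| <= 1) -> exists psi (m : R),
  [/\ `|m| <= 1, test (cutoff a b psi) (cutoff a b (fun x => g x - m)) &
    forall x, x \in `]a, b[ -> `|psi x| <= 2 * (b - a)].
Proof.
move=> a0 ab b1 cg g1; have mg : measurable_fun [set: mR] (g : mR -> R).
  exact: continuous_measurable_fun.
have gi c d : leb.-integrable `[c, d] (EFin \o g) by exact: (@itv_integrable _ _ 1).
have ba0 : 0 < b - a by rewrite subr_gt0.
pose G x := \int[leb]_(t in `[a, x]) g t.
have GM x : x \in `[a, b] -> `|G x| <= x - a.
  rewrite in_itv/= => /andP[ax xb]; rewrite (le_trans (le_normr_Rintegral _ _))//.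
  apply: (@le_trans _ _ (\int[leb]_(t in `[a, x]) 1)).
    apply: le_Rintegral => //; first exact: integrable_norm.
    by apply: (@itv_integrable _ _ 1) => // t _ /=; rewrite normr1.
  rewrite Rintegral_cst// [X in fine X]lebesgue_measure_itv/= lte_fin mul1r.
  by case: ifP => // _; rewrite /= subr_ge0.
pose m := G b / (b - a); pose psi x := G x - m * (x - a).
have m1 : `|m| <= 1.
  rewrite normrM normfV (gtr0_norm ba0) ler_pdivrMr// mul1r GM//.
  by rewrite in_itv/= lexx ltW.
have := parameterized_integral_continuous (ltW ab) (gi a b).
rewrite -/G => /(continuous_within_itvP _ ab)[cG Ga Gb].
have dl x : is_derive x 1 (fun y => m * (y - a)) m.
  by apply: is_derive_eq; rewrite /GRing.scale/=; ring.
have cl : continuous (fun y => m * (y - a)).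
  by move=> x; apply: differentiable_continuous; apply/derivable1_diffP; case: (dl x).
exists psi, m; split => //; last first.
  move=> x xab; rewrite (le_trans (ler_normB _ _))//.
  have := GM x (subset_itv_oo_cc xab); move: xab; rewrite in_itv/= => /andP[ax xb] Gx.
  have : `|m * (x - a)| <= x - a.
    by rewrite normrM (@gtr0_norm _ (x - a)) ?subr_gt0// ler_piMl// subr_ge0 ltW.
  by move: Gx; lra.
apply: (@test_cutoff _ [::] _ _ _ _ 2 a0 ab b1).
- by move=> x xab; apply: continuousB; [exact: cG|exact: cl].
- rewrite -[0](_ : G a - m * (a - a) = 0); last first.
    by rewrite /G set_itv1 Rintegral_set1 subrr mulr0 subrr.
  by apply: cvgB; [exact: Ga|exact: cvg_at_right_filter (cl a)].
- rewrite -[0](_ : G b - m * (b - a) = 0); last first.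
    by rewrite /m divfK ?subrr// gt_eqF.
  by apply: cvgB; [exact: Gb|exact: cvg_at_left_filter (cl b)].
- move=> x _; rewrite (le_trans (ler_normB _ _))//.
  by have := g1 x; move: m1; lra.
- move=> x xab _; split; last first.
    by apply: continuousB; [exact: cg|exact: cst_continuous].
  move: xab; rewrite in_itv/= => /andP[ax xb].
  have [dG G'] := continuous_FTC1_closed xb (gi a b) ax (cg x).
  have dG' : is_derive x 1 G (g x) by rewrite -G' derive1E; exact: derivableP.
  exact: (is_deriveB dG' (dl x)).
Qed.

(** A Poincare inequality. On each cell a test function [g] is split into its mean and a remainder.
    The remainders are together the derivative of a function bounded by [2 d], to which the
    variation bound applies; the means, at most 1, multiply the integrals of [F] over the cells. *)
Lemma dualBV_norm1_partition F C s (d : R) : integ F -> 0 <= C -> dualBV F C ->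
  itv_partition 0 1 s ->
  (forall i, (i < size s)%N -> node s i.+1 - node s i <= d) ->
  norm1 F <= C * (2 * d) +
    \sum_(i < size s) `|pair F \1_(`]node s i, node s i.+1[%classic : set mR)|.
Proof.
move=> iF C0 bvF ips dd; apply: norm1_le_dual => // g cg g1.
have bg : bmeas g by split; [exact: continuous_measurable_fun|exists 1].
have d0 : 0 <= d.
  case: s ips dd => [|b s] ips dd.
    by have := itv_partition_nil ips => /eqP; rewrite eq_sym oner_eq0.
  by rewrite (le_trans _ (dd 0%N _))// subr_ge0 ltW// node_lt.
have /choice[pm HP] : forall i, exists pm : (R -> R) * R, (i < size s)%N ->
    [/\ `|pm.2| <= 1, test (cutoff (node s i) (node s i.+1) pm.1)
        (cutoff (node s i) (node s i.+1) (fun x => g x - pm.2)) &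
      forall x, x \in `]node s i, node s i.+1[ -> `|pm.1 x| <= 2 * d].
  move=> i; have [si|] := boolP (i < size s)%N; last by exists (cst 0, 0).
  have /andP[a0 _] := node01 ips (ltnW si); have /andP[_ b1] := node01 ips si.
  have [psi [m [m1 tm psiM]]] := test_mean a0 (node_lt ips si) b1 cg g1.
  exists (psi, m) => _; split => // x /psiM /le_trans -> //.
  by rewrite ler_pM2l// dd.
pose phi_ i := cutoff (node s i) (node s i.+1) (pm i).1.
pose u_ i := cutoff (node s i) (node s i.+1) (fun x => g x - (pm i).2).
have tst := @test_sum R (size s) phi_ u_ (fun i si => let: And3 _ t _ := HP i si in t).
set phi := (X in test X _) in tst; set u := (X in test _ X) in tst.
have phi_le x : `|phi x| <= 2 * d.
  have [[i [si xi]]|nx] := pselect (exists i, (i < size s)%N /\ x \in `]node s i, node s i.+1[).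
    rewrite /phi (sum_ord_single (c := fun j => phi_ j x) si).
      by rewrite /phi_ /cutoff xi; have [_ _ +] := HP i si; exact.
    move=> j sj ji; rewrite /phi_ /cutoff ifN//.
    by apply: contra ji => xj; apply/eqP; exact: (piece_disjoint ips sj si xj xi).
  rewrite /phi big1 ?normr0 ?mulr_ge0// => i _; rewrite /phi_ /cutoff ifN//.
  by apply/negP => xi; apply: nx; exists i.
pose v_ i : R -> R := (pm i).2 \*o \1_(`]node s i, node s i.+1[%classic : set mR).
have bI i : bmeas (\1_(`]node s i, node s i.+1[%classic : set mR) : R -> R).
  by apply: bmeas_indic; exact: measurable_itv.
have bv i : (i < size s)%N -> bmeas (v_ i) by move=> _; exact: bmeasZ.
have bV := bmeas_sum bv.
have bu := test_bmeas tst.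
have guv x : I01 x -> x \notin 0 :: s -> g x = u x + \sum_(i < size s) v_ i x.
  move=> Ix xs; have [i si xi] := in_piece ips Ix xs.
  have z j : (j < size s)%N -> j != i -> x \notin `]node s j, node s j.+1[.
    move=> sj ji; apply: contra ji => xj; apply/eqP.
    exact: (piece_disjoint ips sj si xj xi).
  rewrite /u (sum_ord_single (c := fun j => u_ j x) si); last first.
    by move=> j sj ji; rewrite /u_ /cutoff ifN// z.
  rewrite (sum_ord_single (c := fun j => v_ j x) si); last first.
    by move=> j sj ji; rewrite /v_/= indicE memNset ?mulr0//; exact/negP/z.
  by rewrite /u_ /cutoff xi /v_/= indicE mem_set// mulr1 subrK.
have -> : pair F g = pair F u +
    \sum_(i < size s) (pm i).2 * pair F \1_(`]node s i, node s i.+1[%classic : set mR).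
  transitivity (pair F (u \+ (fun x => \sum_(i < size s) v_ i x))).
    apply: ae_eq_Rintegral; [exact: integM|by apply: integM => //; exact: bmeasD|].
    by apply: ae_mIS2 (ae_I01 R) (ae_off_finite (0 :: s)) => x Ix xs _; rewrite guv.
  rewrite pairDr// pair_sumr//; congr (_ + _); apply: eq_bigr => i _.
  by rewrite pairZr.
rewrite (le_trans (ler_normD _ _))// lerD//; first exact: (bvF _ _ _ tst phi_le).
rewrite (le_trans (ler_norm_sum _ _ _))// ler_sum// => i _.
by rewrite normrM ler_piMl//; have [] := HP i (ltn_ord i).
Qed.

Definition uniform_partition n : seq R := mkseq (fun k => k.+1%:R / n.+1%:R) n.+1.

Lemma node_uniform n i : (i <= n.+1)%N -> node (uniform_partition n) i = i%:R / n.+1%:R.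
Proof.
by case: i => [_|i ni]; rewrite /node/= ?mul0r// -/(uniform_partition n) nth_mkseq.
Qed.

Lemma uniform_partitionP n : itv_partition 0 1 (uniform_partition n).
Proof.
split.
  apply/(pathP (0 : R)) => i; rewrite size_mkseq => ni.
  rewrite -[ltRHS]/(node (uniform_partition n) i.+1).
  rewrite -[ltLHS]/(node (uniform_partition n) i) !node_uniform// 1?ltnW//.
  by rewrite ltr_pM2r ?invr_gt0// ltr_nat.
rewrite (last_nth 0) size_mkseq -/(node (uniform_partition n) n.+1).
by rewrite node_uniform// divff.
Qed.

Lemma dualBV_norm1_le F C n : integ F -> 0 <= C -> dualBV F C ->
  norm1 F <= C * (2 / n.+1%:R) + \sum_(i < n.+1)
    `|pair F \1_(`](i%:R / n.+1%:R), (i.+1%:R / n.+1%:R)[%classic : set mR)|.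
Proof.
move=> iF C0 bvF; have ips := uniform_partitionP n.
have sz : size (uniform_partition n) = n.+1 by rewrite size_mkseq.
have := @dualBV_norm1_partition F C _ n.+1%:R^-1 iF C0 bvF ips.
rewrite sz => /(_ _)/le_trans -> //.
  move=> i ni; rewrite !node_uniform// 1?ltnW// -mulrBl -natrB// subSnn mul1r//.
rewrite lerD2l ler_sum// => i _; rewrite !node_uniform// ltnW//.
Qed.

End dual_norm.

(** * Completeness, and compactness of sets of bounded variation *)

Section completeness.
Variable R : realType.
Notation mR := (measurableTypeR R).
Implicit Types (F G h : R -> R) (e c C : R).

Lemma summable_increments_cvg (v : R^nat) c :
  (forall n, \sum_(0 <= k < n) `|v k.+1 - v k| <= c) ->
  cvgn v /\ forall n, `|v n| <= `|v 0%N| + c.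
Proof.
move=> vc; have vE n : v n = v 0%N + series (telescope v) n by exact: eq_sum_telescope.
have vc' n : \sum_(0 <= k < n) `|telescope v k| <= c.
  by apply: le_trans (vc n); rewrite /telescope.
split.
  have -> : v = cst (v 0%N) \+ series (telescope v) by apply/funext => n; exact: vE.
  apply: is_cvgD; first exact: is_cvg_cst.
  have nE n : [normed series (telescope v)] n = \sum_(0 <= k < n) `|telescope v k| by [].
  apply: normed_cvg; apply: nondecreasing_is_cvgn.
    apply/nondecreasing_seqP => n.
    by rewrite !nE big_nat_recr//= lerDl.
  by exists c => _ [n _ <-]; exact: vc'.
move=> n; rewrite vE (le_trans (ler_normD _ _))// lerD2l.
by rewrite (le_trans _ (vc' n))// /series/= ler_norm_sum.
Qed.

(** The Riesz-Fischer argument: the sum [S] of the absolute increments has a finite integral, by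
    comparison with a geometric series. So the sequence converges wherever [S] is finite, and
    [|h_ 0| + S] dominates it. *)
Lemma L1_complete (h_ : nat -> R -> R) : (forall k, integ (h_ k)) ->
  (forall k, norm1 (h_ k.+1 \- h_ k) <= (2^-1) ^+ k) ->
  exists2 h, integ h & norm1 (h_ k \- h) @[k --> \oo] --> (0 : R).
Proof.
move=> ih hd.
pose d k x : R := `|h_ k.+1 x - h_ k x|.
have id k : integ (d k) by apply: integ_norm; exact: integB.
have md k : measurable_fun [set: mR] (fun x => (d k x)%:E) := measurable_int mI (id k).
pose S x : \bar R := (\sum_(0 <= k <oo) (d k x)%:E)%E.
have d0 k (x : mR) : setT x -> (0 <= (d k x)%:E)%E.
  by move=> _; rewrite lee_fin normr_ge0.
have mS : measurable_fun [set: mR] S.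
  by apply: ge0_emeasurable_sum => // k x _ _; exact: d0.
have S0 x : (0 <= S x)%E by apply: nneseries_ge0 => k _ _; exact: d0.
have iS : mI.-integrable [set: mR] S.
  apply/integrableP; split => //.
  under eq_integral do rewrite gee0_abs//.
  rewrite integral_nneseries//.
  apply: (@le_lt_trans _ _ (\sum_(0 <= k <oo) ((2^-1 : R) ^+ k)%:E)%E).
    apply: lee_nneseries => [k _ _|k _]; first by apply: integral_ge0 => x _; exact: d0.
    rewrite (_ : (\int[mI]_x (d k x)%:E)%E = (norm1 (h_ k.+1 \- h_ k))%:E).
      by rewrite lee_fin.
    by rewrite -norm1E//; apply: integB.
  apply: (@le_lt_trans _ _ 2%:E); last exact: ltry.
  apply: lime_le; first by apply: is_cvg_nneseries => k _ _; rewrite lee_fin exprn_ge0.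
  near=> n; rewrite sumEFin lee_fin.
  suff -> : \sum_(0 <= k < n) (2^-1 : R) ^+ k = 2 - 2 * 2^-1 ^+ n.
    by rewrite gerBl mulr_ge0// exprn_ge0.
  elim: (n) => [|m IH]; first by rewrite big_geq// expr0; lra.
  by rewrite big_nat_recr//= IH exprS; lra.
(* The upper limit is defined everywhere and measurable, and is the limit wherever [S] is finite. *)
pose f x : \bar R := limn_esup (fun k => (h_ k x)%:E).
have mf : measurable_fun [set: mR] f.
  by apply: measurable_fun_limn_esup => k; exact: (measurable_int mI (ih k)).
have Sfin : {ae @mI R, forall x, S x \is a fin_num}.
  by apply: ae_mIS (integrable_ae measurableT iS) => x; exact.
have Sle x n : S x \is a fin_num -> \sum_(0 <= k < n) d k x <= fine (S x).
  move=> Sx; rewrite -lee_fin fineK// -sumEFin.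
  by apply: nneseries_lim_ge => k _ _; exact: d0.
pose g x : \bar R := (`|(h_ 0%N x)%:E| + S x)%E.
have ig : mI.-integrable [set: mR] g.
  by apply: integrableD => //; apply: integrable_abse; exact: ih.
have [] := @dominated_convergence _ _ _ mI setT measurableT (fun k x => (h_ k x)%:E) f g.
- by move=> k; exact: (measurable_int mI (ih k)).
- exact: mf.
- apply: ae_mIS Sfin => x Sx _.
  have [cv _] := summable_increments_cvg (v := h_ ^~ x) (fun n => Sle x n Sx).
  have cE : (fun k => (h_ k x)%:E) @ \oo --> (limn (h_ ^~ x))%:E.
    by apply: cvg_EFin; [near=> n|].
  by rewrite /f is_cvg_limn_esupE ?(cvg_lim _ cE)//; apply/cvg_ex; eexists; exact: cE.
- exact: ig.
- apply: ae_mIS Sfin => x Sx n _.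
  have [_ /(_ n) b] := summable_increments_cvg (v := h_ ^~ x) (fun n => Sle x n Sx).
  by rewrite /g -(fineK Sx) /= -EFinD lee_fin.
move=> fi f_cvg _.
pose h x := fine (f x).
have ih' : integ h.
  apply: (@le_integrable _ _ _ mI setT _ (EFin \o h) f) => //.
    by apply/measurable_EFinP; apply: measurableT_comp.
  move=> x _ /=; rewrite /h; case: (f x) => [r||] /=; rewrite ?lexx ?leey//.
exists h => //.
have E k : (\int[@mI R]_x `|(h_ k x)%:E - f x| = (norm1 (h_ k \- h))%:E)%E.
  rewrite -norm1E; last exact: integB.
  apply: ae_eq_integral => //.
  - by apply: measurableT_comp => //; apply: emeasurable_funB => //; exact: (measurable_int mI (ih k)).
  - by apply: measurableT_comp => //; exact: (measurable_int mI (integB (ih k) ih')).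
  - apply: ae_mIS (integrable_ae measurableT fi) => x /(_ I) fx _.
    by rewrite /= -(fineK fx).
move: f_cvg; rewrite (_ : [sequence _]_n = EFin \o (fun k => norm1 (h_ k \- h))).
  by move=> /fine_cvgP[].
by apply/funext => k /=; exact: E.
Unshelve. all: by end_near. Qed.

Definition L1fun_of F (iF : integ F) : L1fun R :=
  Lfun_Sub (@lexx _ _ 1%E) ((Lfun1_integrable mI F).2 iF).

Definition L1_of F (iF : integ F) : L1 R := to_L1 (L1fun_of iF).

Lemma L1_ofE F (iF : integ F) : L1_fun (L1_of iF) = F %[ae mI].
Proof. exact: to_L1E. Qed.

Lemma mdistE (u v : L1 R) : mdist u v = norm1 (L1_fun u \- L1_fun v).
Proof. by rewrite /norm1 /Rintegral -[LHS]/(L1_dist u v) /L1_dist Lnorm1. Qed.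

(** For a fixed test function, the pairing with its bounded derivative is continuous for the L^1
    norm. *)
Lemma dualBV_closed F C : integ F -> (forall e, 0 < e ->
    exists G, [/\ integ G, dualBV G C & norm1 (F \- G) < e]) -> dualBV F C.
Proof.
move=> iF FC phi u M tu phiM; have bu := test_bmeas tu.
have [_ [K uK]] := bu; have K0 : 0 <= K by exact: le_trans (uK 0).
apply/ler_addgt0Pr => e e0.
(* [K] may be 0; [K + 1] is a safe divisor. *)
have K1 : 0 < K + 1 by lra.
have [|G [iG GC FG]] := FC (e / (K + 1)); first by rewrite divr_gt0.
have -> : pair F u = pair G u + pair (F \- G) u by rewrite pairBl// addrC subrK.
rewrite (le_trans (ler_normD _ _))// lerD//; first exact: GC phiM.
apply: (@le_trans _ _ (K * norm1 (F \- G))).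
  by apply: pair_le => //; exact: integB.
move: FG; rewrite ltr_pdivlMr// => FG.
have := norm1_ge0 (F \- G); nra.
Qed.

(** The image ultrafilter lives on the compact interval [[- c, c]], so it has a cluster point; an
    ultrafilter contains the preimage of each ball around it, since otherwise it would contain the
    complement. *)
Lemma ultra_oscillation (T : Type) (U : set_system T) (l : T -> R) (c e : R) :
  UltraFilter U -> U [set t | `|l t| <= c] -> 0 < e ->
  exists2 S, U S & forall s t, S s -> S t -> `|l s - l t| < e.
Proof.
move=> UU Uc e0; have PU : ProperFilter U := @ultra_proper _ _ UU.
have [|x [_ xc]] := @segment_compact R (- c) c (l @ U) _ _.
  by apply: filterS Uc => t lt; rewrite /= in_itv/= -ler_norml; exact: lt.
exists (l @^-1` ball x (e / 2)); last first.
  move=> s t; rewrite /ball/= => ls lt.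
  rewrite (splitr e) (le_lt_trans _ (ltrD ls lt))// (le_trans _ (ler_normB _ _))//.
  by rewrite distrC le_eqVlt; apply/orP; left; apply/eqP; congr (`| _ |); ring.
have [//|UC] := in_ultra_setVsetC (l @^-1` ball x (e / 2)) UU.
have [y [/= yC yx]] := xc (~` ball x (e / 2)) (ball x (e / 2)) UC
  (nbhsx_ballx _ _ (divr_gt0 e0 (ltr0Sn _ _))).
by case: yC.
Qed.

(** Points chosen in members of [U] of diameter at most [2^-k] form a Cauchy sequence, and its limit
    attracts the whole of [U]. *)
Lemma L1_ultra_cvg (U : set_system (L1 R)) : UltraFilter U ->
  (forall e, 0 < e -> exists2 S, U S & forall u v, S u -> S v -> mdist u v < e) ->
  exists g : L1 R, U --> g.
Proof.
move=> UU cauchyU; have PU : ProperFilter U := @ultra_proper _ _ UU.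
have p0 k : 0 < (2^-1 : R) ^+ k by rewrite exprn_gt0// invr_gt0.
have /choice[S HS] : forall k : nat, exists S, U S /\
    forall u v, S u -> S v -> mdist u v < (2^-1 : R) ^+ k.
  by move=> k; have [S US HS] := cauchyU _ (p0 k); exists S.
(* The members are nested so that [w k] and [w k.+1] both lie in [S k]. *)
pose S' k := [set u | forall j, (j <= k)%N -> S j u].
have US' k : U (S' k).
  elim: k => [|k ih].
    by apply: filterS (HS 0%N).1 => u Su j; rewrite leqn0 => /eqP ->.
  apply: filterS2 ih (HS k.+1).1 => u ih Su j; rewrite leq_eqVlt => /predU1P[->//|].
  exact: ih.
have /choice[w Hw] : forall k, exists u, S' k u.
  by move=> k; have /filter_ex[u Su] := US' k; exists u.
have [k|k|h ih hcvg] := @L1_complete (fun k => L1_fun (w k)).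
- exact: L1_fun_integrable.
- rewrite -mdistE ltW//; apply: (HS k).2; last exact: Hw.
  exact: Hw (leqnSn k).
exists (L1_of ih); apply/cvg_ballP => e e0.
have e20 : 0 < e / 2 by rewrite divr_gt0.
have pk : ((2^-1 : R) ^+ k) @[k --> \oo] --> (0 : R).
  by apply: cvg_expr; rewrite ger0_norm//; lra.
have [n [/= n1 n2]] : exists n, norm1 (L1_fun (w n) \- h) < e / 2 /\ (2^-1 : R) ^+ n < e / 2.
  have /cvgrPdist_lt/(_ _ e20)[n1 _ H1] := hcvg.
  have /cvgrPdist_lt/(_ _ e20)[n2 _ H2] := pk.
  exists (maxn n1 n2); split.
    have := H1 _ (leq_maxl n1 n2); rewrite /= sub0r normrN.
    exact: le_lt_trans (ler_norm _).
  have := H2 _ (leq_maxr n1 n2); rewrite /= sub0r normrN.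
  exact: le_lt_trans (ler_norm _).
apply: filterS (HS n).1 => v Sv.
rewrite ballEmdist/= (splitr e).
apply: le_lt_trans (metric_triangle _ (w n) _) _; apply: ltrD.
  rewrite mdistE norm1C; apply: le_lt_trans n1.
  rewrite le_eqVlt; apply/orP; left; apply/eqP; apply: ae_eq_Rintegral.
  - by apply: integ_norm; apply: integB; exact: L1_fun_integrable.
  - by apply: integ_norm; apply: integB => //; exact: L1_fun_integrable.
  - by apply: ae_mIS (L1_ofE ih) => x /(_ I) e' _ /=; rewrite e'.
apply: lt_trans n2; apply: (HS n).2 => //; exact: Hw.
Qed.

(** A form of Helly's selection theorem in L^1. *)
Lemma dualBV_compact C : 0 <= C ->
  compact [set u : L1 R | dualBV (L1_fun u) C /\ norm1 (L1_fun u) <= 1].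
Proof.
move=> C0; rewrite compact_ultra => U UU UK; have PU : ProperFilter U := @ultra_proper _ _ UU.
have iL (u : L1 R) : integ (L1_fun u) by exact: L1_fun_integrable.
set K := [set u | _] in UK *.
have small e : 0 < e -> exists2 S, U S & forall u v, S u -> S v -> mdist u v < e.
  (* Differences have variation at most [C + C], so [n.+1 >= 8 C / e] makes the variation term of
     [dualBV_norm1_le] at most [e / 2]; the other half is shared equally by the [n.+1] cells. *)
  move=> e0; pose n := Num.bound (8 * C / e).
  have Cn : (C + C) * (2 / n.+1%:R) <= e / 2.
    have : 8 * C / e < n.+1%:R.
      by rewrite (lt_trans (archi_boundP _)) ?ltr_nat// divr_ge0 ?mulr_ge0// ltW.
    rewrite ltr_pdivrMr// => Ce.
    by rewrite mulrA ler_pdivrMr//; lra.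
  pose l i (u : L1 R) : R :=
    pair (L1_fun u) \1_(`](i%:R / n.+1%:R), (i.+1%:R / n.+1%:R)[%classic : set mR).
  have bJ i : bmeas (\1_(`](i%:R / n.+1%:R), (i.+1%:R / n.+1%:R)[%classic : set mR) : R -> R).
    by apply: bmeas_indic; exact: measurable_itv.
  have Ul i : U [set u | `|l i u| <= 1].
    apply: filterS UK => u [_ u1]; rewrite /= (le_trans _ u1)// -[leRHS]mul1r.
    apply: pair_le => // x _; rewrite indicE; case: (_ \in _);
      by rewrite ?normr1 ?normr0.
  have d0 : 0 < e / 2 / (n.+1%:R) by rewrite divr_gt0// divr_gt0.
  have /choice[S HS] : forall i, exists S, U S /\
      forall u v, S u -> S v -> `|l i u - l i v| < e / 2 / n.+1%:R.
    by move=> i; have [S US HS] := ultra_oscillation UU (Ul i) d0; exists S.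
  have US m : U [set u | forall i, (i < m)%N -> S i u].
    elim: m => [|m ih]; first by apply: filterS UK => u _ i.
    apply: filterS2 ih (HS m).1 => u ih Sm i; rewrite ltnS leq_eqVlt => /predU1P[->//|].
    exact: ih.
  exists (K `&` [set u | forall i, (i < n.+1)%N -> S i u]); first exact: filterI.
  move=> u v [[uC _] uS] [[vC _] vS]; rewrite mdistE.
  have uvC : dualBV (L1_fun u \- L1_fun v) (C + C).
    move=> phi w M tw phiM; rewrite pairBl//; last exact: test_bmeas tw.
    by rewrite (le_trans (ler_normB _ _))// mulrDl lerD//; [exact: (uC phi)|exact: (vC phi)].
  apply: le_lt_trans (dualBV_norm1_le n (integB (iL u) (iL v)) (addr_ge0 C0 C0) uvC) _.
  rewrite [X in _ < X]splitr; apply: ler_ltD => //.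
  apply: (@lt_le_trans _ _ (\sum_(i < n.+1) (e / 2 / n.+1%:R))); last first.
    by rewrite sumr_const card_ord -[leLHS]mulr_natr divfK.
  apply: ltr_sum; first by apply/hasP; exists ord0; rewrite ?mem_index_enum.
  by move=> i _; rewrite pairBl//; apply: (HS i).2; [exact: uS|exact: vS].
have [g Ug] := L1_ultra_cvg UU small; exists g; split => //.
have near_g e : 0 < e -> exists2 u, K u & mdist g u < e.
  move=> e0; have Ub : U (ball g e) by apply: Ug; exact: nbhsx_ballx e0.
  have /filter_ex[u [Ku]] : U (K `&` ball g e) by exact: filterI.
  by rewrite ballEmdist => gu; exists u.
split.
  apply: dualBV_closed => // e e0; have [u [uC _] gu] := near_g e e0.
  by exists (L1_fun u); rewrite -mdistE.
have i0 : integ (cst 0 : R -> R) by exact/bmeas_integ/bmeas_cst.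
apply/ler_addgt0Pl => e e0; have [u [_ u1] gu] := near_g e e0.
have n0 F : norm1 F = norm1 (F \- cst 0) by apply: eq_Rintegral => x _ /=; rewrite subr0.
rewrite n0 (le_trans (norm1_triangle (iL g) (iL u) i0))// lerD//.
  by rewrite -mdistE ltW.
by rewrite -n0.
Qed.

End completeness.

(** * Orbit of the initial density *)

Section composed_maps.
Variable R : realType.
Notation mR := (measurableTypeR R).
Implicit Types (F G H T S h : R -> R) (C M : R).

Lemma restrict_comp_measurable T S : set_fun I01 I01 S ->
  measurable_fun [set: mR] (S \_ I01 : mR -> mR) ->
  measurable_fun [set: mR] (T \_ I01 : mR -> mR) ->
  measurable_fun [set: mR] ((T \o S) \_ I01 : mR -> mR).
Proof.
move=> SI mS mT; have mI01 := @measurable_I01 R.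
rewrite (_ : (T \o S) \_ I01 = ((T \_ I01) \o (S \_ I01)) \_ I01); last first.
  apply/funext => x; rewrite !patchE; case: ifPn => // /set_mem Ix.
  by rewrite /= !patchE (mem_set Ix) mem_set//; exact: SI.
apply/(measurable_restrict _ mI01 measurableT).
by apply: measurable_funTS; exact: measurableT_comp.
Qed.

Lemma transfer_id F : integ F -> transfer id F F.
Proof.
move=> iF h bh; apply: eq_pairr => //; last first.
  by move=> x Ix; rewrite /= patchE mem_set.
apply: bmeas_comp => //.
apply/(measurable_restrict _ (@measurable_I01 R) measurableT).
by apply: measurable_funTS; exact: measurable_id.
Qed.

(** This factors a transfer through a composition. The densities of the orbit are each defined from
    [f] by a composed map; this gives the passage from one to the next by a single map. *)
Lemma transfer_comp T S F G H : integ F -> set_fun I01 I01 S ->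
  measurable_fun [set: mR] (S \_ I01 : mR -> mR) ->
  measurable_fun [set: mR] (T \_ I01 : mR -> mR) ->
  transfer S F G -> transfer (T \o S) F H -> transfer T G H.
Proof.
move=> iF SI mS mT FG FH h bh.
have bhT : bmeas (h \o (T \_ I01)) by exact: bmeas_comp.
rewrite FH// FG//; apply: eq_pairr => //.
- by apply: bmeas_comp => //; exact: restrict_comp_measurable.
- by apply: bmeas_comp.
- move=> x Ix; rewrite /= !patchE (mem_set Ix) mem_set//; exact: SI.
Qed.

Lemma L1fun_integ (f : L1fun R) : integ f.
Proof. exact: L1fun_integrable. Qed.

Lemma transfer_Frobenius_Perron T (f : L1fun R) :
  measurable_fun [set: mR] (T \_ I01 : mR -> mR) -> nonsingular T ->
  transfer T f (Frobenius_Perron T f).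
Proof.
move=> mT nsT; apply: transfer_of_sets => //; [exact: L1fun_integ..|].
move=> A mA; congr fine; apply: Frobenius_PerronE => //.
have := (measurable_restrict (T : mR -> mR) (@measurable_I01 R) measurableT).2 mT.
by rewrite setTI.
Qed.

Lemma averageE (tau : nat -> R -> R) (f : L1fun R) n :
  (average tau f n : R -> R) =
  n%:R^-1 \*o (fun x => \sum_(i < n) Frobenius_Perron (compose_upto tau i.+1) f x).
Proof.
have sumE (m : nat) (F : nat -> L1fun R) x :
    (\sum_(1 <= i < m.+1) F i : L1fun R) x = \sum_(i < m) F i.+1 x.
  rewrite big_add1/= big_mkord; elim: m => [|m ih]; first by rewrite !big_ord0.
  by rewrite !big_ord_recr/= -ih.
apply/funext => x.
have e := sumE n (fun i => Frobenius_Perron (compose_upto tau i) f) x.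
by rewrite [RHS]/= -e.
Qed.

Lemma integ_sum n (F : nat -> R -> R) : (forall i, integ (F i)) ->
  integ (fun x => \sum_(i < n) F i x).
Proof.
move=> iF; elim: n => [|n ih].
  have := bmeas_integ (bmeas_cst (0 : R)).
  by congr integ; apply/funext => x; rewrite big_ord0.
have := integD ih (iF n).
by congr integ; apply/funext => x; rewrite big_ord_recr.
Qed.

Lemma pair_suml n (F : nat -> R -> R) h : (forall i, integ (F i)) -> bmeas h ->
  pair (fun x => \sum_(i < n) F i x) h = \sum_(i < n) pair (F i) h.
Proof.
move=> iF bh; elim: n => [|n ih].
  rewrite big_ord0 /pair; under eq_Rintegral do rewrite big_ord0 mul0r.
  by rewrite Rintegral_cst// mul0r.
rewrite big_ord_recr/= -ih -pairDl//; last exact: integ_sum.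
by apply: eq_Rintegral => x _ /=; rewrite big_ord_recr.
Qed.

Lemma pair_average (tau : nat -> R -> R) (f : L1fun R) n h : bmeas h ->
  pair (average tau f n) h =
  n%:R^-1 * \sum_(i < n) pair (Frobenius_Perron (compose_upto tau i.+1) f) h.
Proof.
pose P i : R -> R := Frobenius_Perron (compose_upto tau i.+1) f.
have iP i : integ (P i) by exact: L1fun_integ.
move=> bh; rewrite averageE pairZl//; last exact: (integ_sum n iP).
by rewrite (pair_suml n iP bh).
Qed.

Lemma dualBV_le F C M : dualBV F C -> C <= M -> dualBV F M.
Proof.
move=> FC CM phi u K tu phiK; rewrite (le_trans (FC _ _ _ tu phiK))//.
by rewrite ler_wpM2r// (le_trans _ (phiK 0)).
Qed.

Lemma dualBV_average (tau : nat -> R -> R) (f : L1fun R) n C : (0 < n)%N ->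
  (forall i, dualBV (Frobenius_Perron (compose_upto tau i.+1) f) C) ->
  dualBV (average tau f n) C.
Proof.
move=> n0 FC phi u M tu phiM; rewrite pair_average; last exact: test_bmeas tu.
have n0' : 0 < n%:R :> R by rewrite ltr0n.
rewrite normrM gtr0_norm ?invr_gt0// ler_pdivrMl//.
rewrite (le_trans (ler_norm_sum _ _ _))// mulr_natl -[in leRHS](card_ord n) -sumr_const.
by apply: ler_sum => i _; exact: FC phiM.
Qed.

Lemma norm1_average_le (tau : nat -> R -> R) (f : L1fun R) n : (0 < n)%N ->
  (forall i, norm1 (Frobenius_Perron (compose_upto tau i.+1) f) <= 1) ->
  norm1 (average tau f n) <= 1.
Proof.
move=> n0 F1; apply: norm1_le_dual; first exact: L1fun_integ.
move=> g cg g1; have bg : bmeas g by split; [exact: continuous_measurable_fun|exists 1].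
have n0' : 0 < n%:R :> R by rewrite ltr0n.
rewrite pair_average// normrM gtr0_norm ?invr_gt0// ler_pdivrMl//.
rewrite (le_trans (ler_norm_sum _ _ _))// mulr_natl -[in leRHS](card_ord n) -sumr_const.
apply: ler_sum => i _; rewrite (le_trans _ (F1 i))// -[leRHS]mul1r.
by apply: pair_le => //; exact: L1fun_integ.
Qed.

End composed_maps.

(** * Uniform bounds along the orbit *)

Section orbit.
Variables (R : realType) (tau : nat -> R -> R) (A B : R).
Notation mR := (measurableTypeR R).
Hypothesis tau_I01 : forall n, (0 < n)%N -> set_fun I01 I01 (tau n).
Hypothesis A_lt1 : A < 1.
Hypothesis tau_LY : common_Lasota_Yorke tau A B.

Lemma tau_measurable n : (0 < n)%N -> measurable_fun [set: mR] (tau n \_ I01 : mR -> mR).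
Proof. by move=> /tau_LY[s [lam [pe _ _]]]; exact: restrict_measurable pe. Qed.

Lemma tau_nonsingular n : (0 < n)%N -> nonsingular (tau n).
Proof.
move=> n0; have [s [lam [pe _ _]]] := tau_LY n0.
exact: expanding_nonsingular pe (tau_I01 n0).
Qed.

Lemma compose_uptoP i : [/\ set_fun I01 I01 (compose_upto tau i),
  measurable_fun [set: mR] (compose_upto tau i \_ I01 : mR -> mR) &
  nonsingular (compose_upto tau i)].
Proof.
elim: i => [|i [Ci mi ni]].
  split => //.
  - apply/(measurable_restrict _ (@measurable_I01 R) measurableT).
    by apply: measurable_funTS; exact: measurable_id.
  - by move=> E mE E0; rewrite /= mI_E setIAC setIid setIC -mI_E.
split.
- by move=> x /Ci; exact: tau_I01.
- exact: restrict_comp_measurable Ci mi (tau_measurable (ltn0Sn i)).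
- move=> E mE E0; rewrite (_ : I01 `&` _ =
      I01 `&` compose_upto tau i @^-1` (I01 `&` tau i.+1 @^-1` E)).
    apply: ni; last exact: tau_nonsingular.
    by apply: restrict_preimage => //; exact: tau_measurable.
  by apply/seteqP; split => x /= [Ix]; [move=> ?; do 2 split => //; exact: Ci|move=> []].
Qed.

Variable f : L1fun R.

(** At index 0 this is [f] itself rather than [Frobenius_Perron id f], which is only a version of
    it: [f] is the function with bounded variation that starts the induction. *)
Definition orbit_density i : R -> R :=
  if i is j.+1 then Frobenius_Perron (compose_upto tau j.+1) f else f.

Lemma orbit_integ i : integ (orbit_density i).
Proof. by case: i => [|i]; exact: L1fun_integ. Qed.

Lemma transfer_orbit i : transfer (compose_upto tau i) f (orbit_density i).
Proof.
case: i => [|i]; first exact/transfer_id/L1fun_integ.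
by have [_ mC nC] := compose_uptoP i.+1; exact: transfer_Frobenius_Perron.
Qed.

Lemma transfer_orbitS i : transfer (tau i.+1) (orbit_density i) (orbit_density i.+1).
Proof.
have [Ci mi _] := compose_uptoP i.
apply: transfer_comp (L1fun_integ f) Ci mi _ (transfer_orbit i) (transfer_orbit i.+1).
exact: tau_measurable.
Qed.

Hypotheses (f_BV : bounded_variation 0 1 f) (f_norm : norm1 f <= 1).

Lemma orbit_norm1 i : norm1 (orbit_density i) <= 1.
Proof.
elim: i => [//|i ih]; apply: le_trans ih.
apply: transfer_norm1 (transfer_orbitS i); [exact: orbit_integ..|].
exact: tau_measurable.
Qed.

Lemma orbit_dualBV : exists2 C, 0 <= C & forall i, dualBV (orbit_density i) C.
Proof.
have [C0 fC0] := bounded_variation_dualBV (L1fun_integ f) f_BV.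
have [s1 [lam1 [pe1 A1 B1]]] := tau_LY (ltn0Sn 0).
have LYB_ge0 (T : R -> R) s lam : piecewise_expanding_with T s lam -> 0 <= LY_B T s lam.
  move=> pe; have [ips l1 _] := pe; have l0 := lt_trans ltr01 l1.
  rewrite addr_ge0// divr_ge0 ?(ltW l0)//; first exact: max_derive2_ge0 pe.
  exact/ltW/mesh_min_gt0.
have B0 : 0 <= B by rewrite (le_trans _ B1)// (LYB_ge0 _ _ _ pe1).
have A1' : 0 < 1 - A by rewrite subr_gt0.
(* From [C >= B / (1 - A)] follows [A * C + B <= C], so the bound reproduces itself; [|C0|] covers
   the initial density. *)
pose C := `|C0| + B / (1 - A).
have C_ge0 : 0 <= C by rewrite addr_ge0// divr_ge0// ltW.
exists C => //; elim=> [|i ih].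
  apply: (dualBV_le fC0); rewrite (le_trans (ler_norm _))//.
  by rewrite lerDl divr_ge0// ltW.
have [s [lam [pe LA LB]]] := tau_LY (ltn0Sn i).
have := Lasota_Yorke_dual pe (tau_I01 (ltn0Sn i)) (tau_measurable (ltn0Sn i))
  (orbit_integ i) (transfer_orbitS i) ih.
move=> /dualBV_le; apply.
apply: (@le_trans _ _ (A * C + B)).
  rewrite lerD ?ler_wpM2r// (le_trans _ LB)// ler_piMr ?orbit_norm1//.
  exact: LYB_ge0 pe.
have -> : A * C = C - (1 - A) * C by ring.
rewrite -addrA gerDl addrC subr_le0 /C mulrDr [X in _ + X]mulrC divfK ?gt_eqF//.
by rewrite lerDr mulr_ge0// ltW.
Qed.

End orbit.

(** * Invariance of the limit *)

Section absolute_measure.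
Variable R : realType.
Notation mR := (measurableTypeR R).
Local Open Scope ereal_scope.

(* A density is nonnegative only almost everywhere; the absolute value makes this
   a measure whatever the version [g]. *)
Definition absolute_measure (g : R -> R) (ig : integ g) (g1 : norm1 g = 1%R)
  (A : set mR) : \bar R := \int[@mI R]_(x in A) `|(g x)%:E|.

Variables (g : R -> R) (ig : integ g) (g1 : norm1 g = 1%R).

Let mu := absolute_measure ig g1.

Let mg : measurable_fun [set: mR] (fun x => `|(g x)%:E|).
Proof. by apply: measurableT_comp => //; exact: (measurable_int mI ig). Qed.

Let mu0 : mu set0 = 0. Proof. by rewrite /mu /absolute_measure integral_set0. Qed.

Let mu_ge0 A : 0 <= mu A. Proof. exact: integral_ge0. Qed.

Let mu_sigma_additive : semi_sigma_additive mu.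
Proof. exact: (semi_sigma_additive_nng_induced mg). Qed.

HB.instance Definition _ := isMeasure.Build _ _ _ (absolute_measure ig g1)
  mu0 mu_ge0 mu_sigma_additive.

Let mu1 : mu setT = 1. Proof. by rewrite /mu /absolute_measure norm1E// g1. Qed.

HB.instance Definition _ := Measure_isProbability.Build _ _ _
  (absolute_measure ig g1) mu1.

End absolute_measure.

Section invariance.
Variable R : realType.
Notation mR := (measurableTypeR R).
Implicit Types (F G g h T : R -> R) (a : R).

Lemma pair_dominated F (h_ : nat -> R -> R) h : integ F ->
  (forall k, bmeas (h_ k)) -> (forall k x, `|h_ k x| <= 1) ->
  (forall x, h_ k x @[k --> \oo] --> h x) ->
  pair F (h_ k) @[k --> \oo] --> pair F h.
Proof.
move=> iF bh h1 hh.
have [|||||] := @dominated_convergence _ _ _ mI setT measurableT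
  (fun k x => (F x * h_ k x)%:E) (fun x => (F x * h x)%:E) (fun x => `|(F x)%:E|%E).
- by move=> k; exact: (measurable_int mI (integM iF (bh k))).
- apply/measurable_EFinP; apply: measurable_funM; first exact: integ_measurable.
  apply: (@measurable_fun_cvg _ _ _ setT h_) => [k|x _]; last exact: hh.
  by have [] := bh k.
- by apply: aeW => x _; apply: cvg_EFin; [near=> k|apply: cvgMl_tmp; exact: hh].
- by apply: integrable_abse; exact: iF.
- apply: aeW => x k _; rewrite /= lee_fin normrM ler_piMr//.
move=> iFh _ Fh; rewrite /pair /Rintegral; apply: fine_cvg.
rewrite fineK; first exact: Fh.
exact: (integrable_fin_num measurableT iFh).
Unshelve. all: by end_near. Qed.

(** A [k]-Lipschitz approximation from below of the indicator of the open ray []a, +oo[]. *)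
Definition ramp a (k : nat) (y : R) : R := Num.min 1 (Num.max 0 (k%:R * (y - a))).

Lemma ramp_lipschitz a k x y : `|ramp a k x - ramp a k y| <= k%:R * `|x - y|.
Proof.
have -> : k%:R * `|x - y| = `|k%:R * (x - a) - k%:R * (y - a)|.
  rewrite -mulrBr normrM ger0_norm//; congr (_ * `| _ |); ring.
rewrite /ramp; move: (k%:R * (x - a)) (k%:R * (y - a)) => s t.
rewrite ler_norml; have := ler_norm (s - t); have := lerNnormlW (lexx `|s - t|).
move=> st1 st2.
by case: (leP 0 s) => s0; case: (leP 0 t) => t0; case: (leP 1 s) => s1; case: (leP 1 t) => t1;
  rewrite ?(min_r ler01); apply/andP; split; lra.
Qed.

Lemma ramp_le1 a k x : `|ramp a k x| <= 1.
Proof.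
rewrite ger0_norm; first by rewrite /ramp ge_min lexx.
by rewrite /ramp le_min ler01 le_max lexx.
Qed.

Lemma ramp_bmeas a k : bmeas (ramp a k).
Proof.
split; last by exists 1; exact: ramp_le1.
apply: measurable_minr => //; apply: measurable_maxr => //.
by apply: measurable_funM => //; exact: measurable_funB.
Qed.

Lemma ramp_cvg a x : ramp a k x @[k --> \oo] --> (\1_(`]a, +oo[%classic : set mR) x : R).
Proof.
apply: cvg_near_cst; rewrite indicE; have [xa|ax] := leP x a.
  rewrite memNset/=; last by rewrite in_itv/= andbT ltNge xa.
  near=> k; rewrite /ramp max_l ?min_r//.
  by rewrite mulr_ge0_le0// subr_le0.
rewrite mem_set/=; last by rewrite in_itv/= andbT.
exists (Num.bound (x - a)^-1) => // k /= Nk.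
have xa0 : 0 < x - a by rewrite subr_gt0.
have k1 : 1 <= k%:R * (x - a).
  rewrite -ler_pdivrMr// mul1r ltW// (lt_le_trans (archi_boundP _)) ?ler_nat//.
  by rewrite invr_ge0 ltW.
by rewrite /ramp max_r ?(le_trans ler01)// min_l.
Unshelve. all: by end_near. Qed.

(** The nonnegative function [|g| - g] is [-2 g] times the indicator of [g < 0]; its integral is at
    most 0 by hypothesis, so it vanishes almost everywhere. *)
Lemma ge0_ae_norm g : integ g ->
  (forall A : set mR, measurable A -> 0 <= pair g \1_A) ->
  g = (fun x => `|g x|) %[ae mI].
Proof.
move=> ig g0; pose d : R -> R := (fun x => `|g x|) \- g.
have id : integ d by apply: integB => //; exact: integ_norm.
have mA : measurable ([set x | g x < 0] : set mR).
  rewrite (_ : [set x | _] = g @^-1` `]-oo, 0[%classic).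
    rewrite -[X in measurable X]setTI.
    exact: (integ_measurable ig measurableT (measurable_itv _)).
  by apply/seteqP; split => x /=; rewrite in_itv.
have b2 : bmeas ((-2) \*o \1_[set x | g x < 0]) by apply/bmeasZ/bmeas_indic.
have dE x : d x = g x * ((-2) \*o \1_[set x | g x < 0]) x.
  rewrite /d/= indicE (_ : (x \in _) = (g x < 0)); last first.
    by apply/idP/idP; rewrite inE.
  have [gx|gx] := ltP (g x) 0; first by rewrite ltr0_norm//=; ring.
  by rewrite ger0_norm//=; ring.
have d_ge0 x : 0 <= d x by rewrite subr_ge0 ler_norm.
have nd : norm1 d = 0.
  apply/eqP; rewrite eq_le norm1_ge0 andbT.
  rewrite (_ : norm1 d = pair g ((-2) \*o \1_[set x | g x < 0])); last first.
    by apply: eq_Rintegral => x _; rewrite -dE ger0_norm.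
  rewrite pairZr//; last exact: bmeas_indic.
  by rewrite mulNr oppr_le0 mulr_ge0// g0.
have md := measurable_int mI id.
have := norm1E id; rewrite nd => /(ae_eq_integral_abs mI measurableT md).
apply: ae_mIS => x /(_ I) /= [] /eqP; rewrite subr_eq0 => /eqP dx _.
by rewrite dx.
Qed.

(** Rays are stable under intersection and generate the Borel sets, and the rays from [- n] exhaust
    the line. *)
Lemma measure_eq_rays (m1 m2 : {measure set mR -> \bar R}) :
    (forall a, m1 `]a, +oo[%classic = m2 `]a, +oo[%classic) ->
    (forall a, m1 `]a, +oo[%classic < +oo)%E ->
  forall E : set mR, measurable E -> m1 E = m2 E.
Proof.
move=> rays fin E mE.
apply: (@measure_unique _ R mR (@RGenOInfty.G R) (fun n => `](- n%:R : R), +oo[%classic)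
  (RGenOInfty.measurableE R)) => //.
- move=> _ _ [x ->] [y ->]; exists (Num.max x y).
  by apply/seteqP; split => z /=; rewrite !in_itv/= !andbT gt_max => /andP.
- by move=> n; exists (- n%:R).
- apply/seteqP; split => // x _; exists (Num.bound `|x|) => //=.
  rewrite in_itv/= andbT ltrNl (le_lt_trans (ler_norm _))// normrN.
  exact: archi_boundP.
- by move=> _ [x ->]; exact: rays.
Qed.

Lemma acim_density_invariant T g : set_fun I01 I01 T ->
  measurable_fun [set: mR] (T \_ I01 : mR -> mR) -> integ g ->
  (forall A : set mR, measurable A -> 0 <= pair g \1_A) ->
  pair g (cst 1) = 1 ->
  (forall a k, pair g (ramp a k) = pair g (ramp a k \o (T \_ I01))) ->
  acim_density T g.
Proof.
move=> TI mT ig g0 g1 inv.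
have gabs := ge0_ae_norm ig g0.
have ia := integ_norm ig.
have eqabs h : bmeas h -> pair g h = pair (fun x => `|g x|) h.
  by move=> bh; exact: eq_pairl.
have n1 : norm1 g = 1.
  rewrite -g1 eqabs; last exact: bmeas_cst.
  by apply: eq_Rintegral => x _; rewrite mulr1.
pose mu := absolute_measure ig n1.
have muE (E : set mR) : measurable E -> mu E = (pair g \1_E)%:E.
  move=> mE; rewrite eqabs; last exact: bmeas_indic.
  rewrite pair_indic// /Rintegral fineK//.
  apply: integrable_fin_num => //; exact: (integrableS measurableT mE _ ia).
have mTE (E : set mR) : measurable E -> measurable ((T \_ I01) @^-1` E : set mR).
  by move=> mE; rewrite -[X in measurable X]setTI; exact: mT.
(* Invariance on ramps passes to rays by dominated convergence on both sides; no continuity of [T]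
   enters. *)
have ray a : mu `]a, +oo[%classic = mu ((T \_ I01) @^-1` `]a, +oo[%classic).
  have mray : measurable (`]a, +oo[%classic : set mR) by exact: measurable_itv.
  rewrite !muE//; last exact: mTE.
  congr EFin.
  have L1 := pair_dominated ig (ramp_bmeas a) (ramp_le1 a) (@ramp_cvg a).
  have L2 : pair g (ramp a k \o (T \_ I01)) @[k --> \oo] -->
      pair g (\1_(`]a, +oo[%classic : set mR) \o (T \_ I01)).
    apply: pair_dominated => // [k|k x|x]; first by apply: bmeas_comp => //; exact: ramp_bmeas.
      exact: ramp_le1.
    exact: ramp_cvg.
  have E : (fun k => pair g (ramp a k)) = (fun k => pair g (ramp a k \o (T \_ I01))).
    by apply/funext => k; exact: inv.
  by rewrite E in L1; exact: (cvg_unique _ L1 L2).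
have inv_mu (E : set mR) : measurable E -> mu E = mu ((T \_ I01) @^-1` E).
  have -> : mu ((T \_ I01) @^-1` E) = pushforward mu (T \_ I01 : mR -> mR) E by [].
  apply: (@measure_eq_rays mu (pushforward mu (T \_ I01 : mR -> mR))) => //.
  by move=> n; rewrite (le_lt_trans (probability_le1 _ _)) ?ltry.
have ac : mu `<< mI.
  apply/null_content_dominatesP => E mE E0; apply: null_set_integral => //.
  apply: measurable_funTS; apply: measurableT_comp => //; exact: (measurable_int mI ig).
exists (absolute_measure ig n1 : probability mR R).
  split => //.
    have := (measurable_restrict (T : mR -> mR) (@measurable_I01 R) measurableT).2 mT.
    by rewrite setTI.
  move=> E mE; have mP := restrict_preimage mT mE.
  rewrite [RHS]inv_mu// -/mu [LHS]muE// [RHS]muE//; last exact: mTE.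
  (* The preimages under [T] and under [T \_ I01] agree on [I01], where the measure is
     concentrated. *)
  congr EFin; apply: eq_pairr => //; [exact: bmeas_indic|by apply: bmeas_indic; exact: mTE|].
  move=> x Ix; rewrite !indicE in_setI (mem_set Ix)/=; congr (nat_of_bool _)%:R.
  by apply/idP/idP; rewrite !inE /= patchE (mem_set Ix).
(* [g] and the Radon-Nikodym derivative have the same integral over every measurable set. *)
apply: integral_ae_eq => // E _ mE; rewrite -Radon_Nikodym_integral//.
  rewrite [RHS]muE// pair_indic// /Rintegral fineK//.
  by apply: integrable_fin_num => //; exact: (integrableS measurableT mE _ ig).
Unshelve. all: by end_near. Qed.

End invariance.

(** * Limit points of the averages *)

Section limit.
Variables (R : realType) (tau : nat -> R -> R) (tau_lim : R -> R) (A B : R).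
Notation mR := (measurableTypeR R).
Hypothesis tau_I01 : forall n, (0 < n)%N -> set_fun I01 I01 (tau n).
Hypothesis tau_lim_I01 : set_fun I01 I01 tau_lim.
Hypothesis tau_cvg : {uniform I01, tau @ \oo --> tau_lim}.
Hypothesis tau_LY : common_Lasota_Yorke tau A B.
Variable f : L1fun R.
Hypothesis f_density : is_density f.

Local Notation orb := (orbit_density tau f).

Lemma uniform_I01_near e : 0 < e ->
  \forall n \near \oo, forall x, I01 x -> `|tau_lim x - tau n x| < e.
Proof.
move=> e0.
have U : nbhs (tau_lim : {uniform` I01 -> R})
    [set h : R -> R | forall x, I01 x -> `|tau_lim x - h x| < e].
  apply/uniform_nbhs; exists [set xy | ball xy.1 e xy.2].
  split; first by rewrite -entourage_ballE; exists e.
  by move=> h hlt x Ix; exact: hlt.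
exact: (tau_cvg U).
Qed.

Lemma tau_lim_measurable : measurable_fun [set: mR] (tau_lim \_ I01 : mR -> mR).
Proof.
(* The sequence is shifted because nothing is assumed of [tau 0]. *)
apply: (@measurable_fun_cvg _ _ _ setT (fun n => tau n.+1 \_ I01)) => [n|x _].
  exact: tau_measurable tau_LY _ (ltn0Sn n).
have [Ix|Ix] := boolP (x \in I01); last first.
  by under eq_fun do rewrite patchE (negbTE Ix); rewrite patchE (negbTE Ix); exact: cvg_cst.
under eq_fun do rewrite patchE Ix; rewrite patchE Ix.
apply/cvgrPdist_lt => e e0; have [N _ HN] := uniform_I01_near e0.
by exists N => // n /= Nn; apply: (HN n.+1 (leqW Nn)); exact/set_mem.
Qed.

Lemma density_pair1 : pair f (cst 1) = 1.
Proof.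
rewrite /pair /Rintegral; under eq_integral do rewrite mulr1.
by case: f_density => _ ->.
Qed.

Lemma density_norm1 : norm1 f <= 1.
Proof.
have if_ := L1fun_integ f; have [f0 _] := f_density.
apply: (@le_trans _ _ (pair f (cst 1))); last by rewrite density_pair1.
rewrite le_eqVlt; apply/orP; left; apply/eqP.
apply: eq_Rintegral_I01; [exact: integ_norm|by apply: integM => //; exact: bmeas_cst|].
by move=> x Ix; rewrite mulr1 ger0_norm// f0.
Qed.

Lemma orbit_pair_ge0 i (E : set mR) : measurable E -> 0 <= pair (orb i) \1_E.
Proof.
move=> mE; have if_ := L1fun_integ f; have [f0 _] := f_density.
have bE := bmeas_indic mE.
have [_ mC _] := compose_uptoP tau_I01 tau_LY i.
rewrite (transfer_orbit tau_I01 tau_LY)//.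
have -> : 0 = \int[@mI R]_x (cst 0 x) :> R by rewrite Rintegral_cst// mul0r.
apply: le_Rintegral_I01; first exact/bmeas_integ/bmeas_cst.
  by apply: integM => //; exact: bmeas_comp.
by move=> x Ix; rewrite mulr_ge0 ?f0// indicE.
Qed.

Lemma orbit_pair1 i : pair (orb i) (cst 1) = 1.
Proof.
rewrite (transfer_orbit tau_I01 tau_LY); last exact: bmeas_cst.
exact: density_pair1.
Qed.

Lemma orbit_pair_le1 i h : bmeas h -> (forall x, `|h x| <= 1) -> `|pair (orb i) h| <= 1.
Proof.
move=> bh h1; have o1 := orbit_norm1 tau_I01 tau_LY density_norm1 i.
rewrite (le_trans _ o1)// -[leRHS]mul1r; apply: pair_le => //.
exact: orbit_integ.
Qed.

Lemma average_invariance_defect h (L : R) : bmeas h -> (forall x, `|h x| <= 1) ->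
  0 <= L -> (forall x y, `|h x - h y| <= L * `|x - y|) ->
  pair (average tau f n.+1) h - pair (average tau f n.+1) (h \o (tau_lim \_ I01))
    @[n --> \oo] --> (0 : R).
Proof.
move=> bh h1 L0 hL; set h' := h \o _.
have bh' : bmeas h' by apply: bmeas_comp => //; exact: tau_lim_measurable.
have bht i : bmeas (h \o (tau i.+1 \_ I01)).
  by apply: bmeas_comp => //; exact: tau_measurable tau_LY _ (ltn0Sn i).
(* [orb i.+1] is the summand of index [i] in an average, and [tau i.+2] is the map that transports
   it to the next one. *)
pose err i := pair (orb i.+1) ((h \o (tau i.+2 \_ I01)) \- h').
have err0 : err i @[i --> \oo] --> (0 : R).
  apply/cvgrPdist_le => e e0; have L1 : 0 < L + 1 by lra.
  have [N _ HN] := uniform_I01_near (divr_gt0 e0 L1).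
  exists N => // i /= Ni; rewrite sub0r normrN.
  have o1 := orbit_norm1 tau_I01 tau_LY density_norm1 i.+1.
  apply: (@le_trans _ _ (e * norm1 (orb i.+1))); last by rewrite ler_piMr// ltW.
  apply: pair_le; [exact: orbit_integ|exact: bmeasB|].
  move=> x Ix; rewrite /h'/= !patchE (mem_set Ix).
  rewrite (le_trans (hL _ _))// distrC.
  have := HN i.+2 (leqW (leqW Ni)) x Ix; rewrite ltr_pdivlMr//.
  by have := normr_ge0 (tau_lim x - tau i.+2 x); nra.
pose v i := pair (orb i.+1) h.
have v1 i : `|v i| <= 1 by exact: orbit_pair_le1.
have vE i : v i - pair (orb i.+1) h' = v i - v i.+1 + err i.
  rewrite /err pairBr//; last exact: orbit_integ.
  rewrite -(transfer_orbitS tau_I01 tau_LY f i.+1 bh).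
  by rewrite -/(v i.+1) addrA subrK.
have telescope (w : nat -> R) n : \sum_(i < n.+1) (w i - w i.+1) = w 0%N - w n.+1.
  elim: n => [|n ih]; first by rewrite big_ord_recr big_ord0 /= add0r.
  by rewrite big_ord_recr/= ih addrA subrK.
have DE n : pair (average tau f n.+1) h - pair (average tau f n.+1) h' =
    harmonic n * (v 0%N - v n.+1) + arithmetic_mean err n.
  rewrite !pair_average// -mulrBr -sumrB /harmonic /arithmetic_mean /= -mulrDr.
  congr (_ * _); rewrite /series/= big_mkord.
  rewrite (eq_bigr (fun i : 'I_n.+1 => v i - v i.+1 + err i)); last by move=> i _; exact: vE.
  by rewrite big_split/= telescope.
rewrite (_ : (fun n => _) = (fun n => harmonic n * (v 0%N - v n.+1)) \+ arithmetic_mean err); last first.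
  by apply/funext => n; exact: DE.
rewrite -[0]addr0; apply: cvgD; last exact: cesaro.
(* The telescoped sum has only two terms left, each at most 1 in absolute value. *)
apply: (@squeeze_cvgr _ _ _ _ (fun n => - 2 * harmonic n) (fun n => 2 * harmonic n)).
- near=> n; rewrite mulNr -ler_norml normrM mulrC (ger0_norm (harmonic_ge0 n)).
  rewrite ler_wpM2r ?harmonic_ge0// (le_trans (ler_normB _ _))//.
  exact: (lerD (v1 0%N) (v1 n.+1)).
- by rewrite -[0](mulr0 (- 2)); apply: cvgMl_tmp; exact: cvg_harmonic.
- by rewrite -[0](mulr0 2); apply: cvgMl_tmp; exact: cvg_harmonic.
Unshelve. all: by end_near. Qed.

Variables (phi : nat -> nat) (g : L1 R).
Hypothesis phi_gt0 : forall k, (0 < phi k)%N.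
Hypothesis phi_homo : {homo phi : k l / (k < l)%N}.
Hypothesis g_lim : to_L1 (average tau f (phi k)) @[k --> \oo] --> g.

Lemma pair_subsequence h : bmeas h ->
  pair (average tau f (phi k)) h @[k --> \oo] --> pair (L1_fun g) h.
Proof.
move=> bh; have [_ [K hK]] := bh; have K0 : 0 <= K by exact: le_trans (hK 0).
have ig : integ (L1_fun g) by exact: L1_fun_integrable.
apply/cvgrPdist_le => e e0; have K1 : 0 < K + 1 by lra.
have /cvg_ballP/(_ _ (divr_gt0 e0 K1)) := g_lim.
apply: filterS => k; rewrite ballEmdist/= mdistE.
set u := to_L1 _; have iu : integ (L1_fun u) by exact: L1_fun_integrable.
have -> : pair (average tau f (phi k)) h = pair (L1_fun u) h.
  apply: eq_pairl => //; first exact: L1fun_integ.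
  by apply: ae_mIS (to_L1E (average tau f (phi k))) => x ux /ux.
rewrite -pairBl// ltr_pdivlMr// => gu.
rewrite (le_trans (@pair_le _ _ _ K _ bh _))//; first exact: integB.
by have := norm1_ge0 (L1_fun g \- L1_fun u); nra.
Qed.

Lemma subsequence_limit_acim : acim_density tau_lim (L1_fun g).
Proof.
have ig : integ (L1_fun g) by exact: L1_fun_integrable.
have phi_ge k : (k <= phi k)%N.
  by elim: k => // k ih; exact: leq_ltn_trans ih (phi_homo (ltnSn k)).
have inv_gt0 k : 0 < (phi k)%:R^-1 :> R by rewrite invr_gt0 ltr0n.
apply: acim_density_invariant => //; first exact: tau_lim_measurable.
- move=> E mE; have bE := bmeas_indic mE.
  apply: (cvgr_to_ge (pair_subsequence bE)); near=> k.
  rewrite pair_average//; apply: mulr_ge0; first exact: ltW.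
  apply: sumr_ge0 => i _; exact: (orbit_pair_ge0 i.+1).
- have b1 := bmeas_cst (1 : R).
  apply: (cvg_unique _ (pair_subsequence b1)) => //; apply: cvg_near_cst.
  near=> k; rewrite pair_average//.
  rewrite (eq_bigr (fun=> 1)); last by move=> i _; exact: (orbit_pair1 i.+1).
  by rewrite sumr_const card_ord mulVf// pnatr_eq0 -lt0n.
move=> a m; have bh := ramp_bmeas a m.
have bh' : bmeas (ramp a m \o (tau_lim \_ I01)).
  by apply: bmeas_comp => //; exact: tau_lim_measurable.
have D0 := average_invariance_defect bh (ramp_le1 a m) (ler0n _ m) (ramp_lipschitz a m).
(* The defect is stated for averages of index [n.+1], so it is used at [n = (phi k).-1]. *)
have phi_oo : (phi k).-1 @[k --> \oo] --> \oo.
  move=> P [N _ NP]; exists N.+1 => // k /= Nk; apply: NP => /=.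
  by rewrite -ltnS prednK//; exact: leq_trans (phi_ge k).
have defect0 := cvg_comp _ _ phi_oo D0.
have defect := cvgB (pair_subsequence bh) (pair_subsequence bh').
apply/eqP; rewrite -subr_eq0; apply/eqP.
apply: (cvg_unique _ (defect _)) => //; apply: cvg_trans defect0; apply: near_eq_cvg; near=> k.
by rewrite /= prednK.
Unshelve. all: by end_near. Qed.

End limit.

(** * Precompactness of the averages *)

Section precompactness.
Variables (R : realType) (tau : nat -> R -> R) (A B : R).
Hypothesis tau_I01 : forall n, (0 < n)%N -> set_fun I01 I01 (tau n).
Hypothesis A_lt1 : A < 1.
Hypothesis tau_LY : common_Lasota_Yorke tau A B.
Variable f : L1fun R.
Hypothesis f_BV : bounded_variation 0 1 f.
Hypothesis f_norm : norm1 f <= 1.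

Lemma averages_precompact :
  precompact [set to_L1 (average tau f n) | n in [set n | (0 < n)%N]].
Proof.
have [C C0 orbC] := orbit_dualBV tau_I01 A_lt1 tau_LY f_BV f_norm.
(* The uniform constant [C] places all averages in one of the compact sets of [dualBV_compact]; the
   bounds transfer to the classes because they are given by integrals. *)
apply: precompact_subset (compact_precompact (@metric_hausdorff _ _) (dualBV_compact C0)).
move=> _ [n /= n0 <-].
have av : L1_fun (to_L1 (average tau f n)) = average tau f n %[ae mI] by exact: to_L1E.
have iav : integ (average tau f n) by exact: L1fun_integ.
have iu : integ (L1_fun (to_L1 (average tau f n))) by exact: L1_fun_integrable.
split.
  move=> phi u M tu phiM; rewrite (eq_pairl iu iav (test_bmeas tu) av).
  apply: (dualBV_average n0 _ tu phiM) => i; exact: (orbC i.+1).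
rewrite (_ : norm1 _ = norm1 (average tau f n)).
  apply: norm1_average_le => // i; exact: (orbit_norm1 tau_I01 tau_LY f_norm i.+1).
apply: ae_eq_Rintegral; [exact: integ_norm..|].
by apply: ae_mIS av => x /(_ I) e _ /=; rewrite e.
Qed.

End precompactness.

Theorem theorem4 (R : realType) (tau : nat -> R -> R) (tau_lim : R -> R)
  (A B : R)
  (tau_I01 : forall n, (0 < n)%N -> set_fun I01 I01 (tau n))
  (tau_lim_I01 : set_fun I01 I01 tau_lim)
  (tau_expanding : forall n, (0 < n)%N -> piecewise_expanding (tau n))
  (tau_cvg : {uniform I01, tau @ \oo --> tau_lim})
  (A_lt1 : A < 1)
  (tau_LY : common_Lasota_Yorke tau A B)
  (f : L1fun R) (f_BV : BV_I01 f) (f_density : is_density f) :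
  precompact [set to_L1 (average tau f n) | n in [set n | (0 < n)%N]] /\
  (forall (phi : nat -> nat) (g : L1 R),
     (forall k, (0 < phi k)%N) -> {homo phi : k l / (k < l)%N} ->
     to_L1 (average tau f (phi k)) @[k --> \oo] --> g ->
     acim_density tau_lim (L1_fun g)).
Proof.
have [fBV _] := f_BV; split.
  have precompactness := averages_precompact tau_I01 A_lt1 tau_LY.
  exact: (precompactness f fBV (density_norm1 f_density)).
move=> phi g phi_gt0 phi_homo g_lim.
have limit_acim := subsequence_limit_acim tau_I01 tau_lim_I01 tau_cvg tau_LY f_density.
exact: limit_acim phi_gt0 phi_homo g_lim.
Qed.
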